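(* Let $K\ge 0$ be an integer and let $(\mathbf{y}_t)_{t\ge 0}$ be the NN-$K$ iterates $$\mathbf{y}_{t+1}=\mathbf{y}_t-\epsilon\,\mathbf{D}_t^{-1/2}\sum_{k=0}^{K}\left(\mathbf{D}_t^{-1/2}\mathbf{B}\mathbf{D}_t^{-1/2}\right)^{k}\mathbf{D}_t^{-1/2}\mathbf{g}_t ,$$ started from an arbitrary $\mathbf{y}_0\in\mathbb{R}^{np}$ and run on the penalized objective $F$, with $\mathbf{g}_t,\mathbf{D}_t,\mathbf{B}$, the stepsize $\epsilon$ and the constants $\rho,\zeta,\Gamma_1,\Gamma_2$ as defined in the context. Assume: (i) there are constants $0\le\delta\le\Delta<1$ with $\delta\le w_{ii}\le\Delta$ for all $i=1,\dots,n$; (ii) the functions $f_i:\mathbb{R}^p\to\mathbb{R}$ are twice differentiable and there are constants $0<m\le M<\infty$ with $m\mathbf{I}\preceq\nabla^2 f_i(\mathbf{x})\preceq M\mathbf{I}$ for all $\mathbf{x}\in\mathbb{R}^p$ and all $i$; (iii) $\|\nabla^2 f_i(\mathbf{x})-\nabla^2 f_i(\hat{\mathbf{x}})\|\le L\|\mathbf{x}-\hat{\mathbf{x}}\|$ for all $\mathbf{x},\hat{\mathbf{x}}\in\mathbb{R}^p$ and all $i$ (with $L>0$, so that $\Gamma_2>0$). For integers $t\ge 1$ define $$\eta_t:=\left(1-\epsilon+\epsilon\rho^{K+1}\right)\left(1+\Gamma_1(1-\zeta)^{\frac{t-1}{4}}\right),$$ and let $t_0$ be the first $t$ for which $\eta_t<1$.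 Then for every $t\ge t_0$ for which $$\frac{\sqrt{\eta_t}\,(1-\sqrt{\eta_t})}{\epsilon^2\Gamma_2}\le\left\|\mathbf{D}_{t-1}^{-1/2}\mathbf{g}_t\right\|<\frac{1-\sqrt{\eta_t}}{\epsilon^2\Gamma_2},$$ the rate of convergence is quadratic in the sense that $$\left\|\mathbf{D}_t^{-1/2}\mathbf{g}_{t+1}\right\|\le\frac{\epsilon^2\Gamma_2}{1-\sqrt{\eta_t}}\left\|\mathbf{D}_{t-1}^{-1/2}\mathbf{g}_t\right\|^2 .$$
   Context: Network and weights. A connected, undirected (symmetric) network has $n$ agents $i=1,\dots,n$ with neighborhoods $\mathcal{N}_i$. The weight matrix $\mathbf{W}=(w_{ij})\in\mathbb{R}^{n\times n}$ has the sparsity pattern of the network ($w_{ij}=0$ if $j\ne i$ and $j\notin\mathcal{N}_i$), is symmetric and row stochastic (nonnegative entries, $\mathbf{W}\mathbf{1}=\mathbf{1}$), and satisfies $\mathrm{null}(\mathbf{I}-\mathbf{W})=\mathrm{span}(\mathbf{1})$. Set $\mathbf{Z}:=\mathbf{W}\otimes\mathbf{I}_p\in\mathbb{R}^{np\times np}$ and let $\mathbf{Z}_d:=\mathrm{diag}(\mathbf{Z})$ be the diagonal matrix with the same diagonal as $\mathbf{Z}$. Penalized objective. Each agent has a strongly convex local function $f_i:\mathbb{R}^p\to\mathbb{R}$. For $\mathbf{y}=[\mathbf{x}_1;\dots;\mathbf{x}_n]\in\mathbb{R}^{np}$ (stacked vectors $\mathbf{x}_i\in\mathbb{R}^p$)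 and a fixed $\alpha>0$, $$F(\mathbf{y}):=\tfrac12\,\mathbf{y}^T(\mathbf{I}-\mathbf{Z})\mathbf{y}+\alpha\sum_{i=1}^n f_i(\mathbf{x}_i),$$ and $\mathbf{y}^*:=\arg\min F$. Quantities at the iterate $\mathbf{y}_t=[\mathbf{x}_{1,t};\dots;\mathbf{x}_{n,t}]$. Gradient: $\mathbf{g}_t:=\nabla F(\mathbf{y}_t)=(\mathbf{I}-\mathbf{Z})\mathbf{y}_t+\alpha[\nabla f_1(\mathbf{x}_{1,t});\dots;\nabla f_n(\mathbf{x}_{n,t})]$. Let $\mathbf{G}_t\in\mathbb{R}^{np\times np}$ be block diagonal with $i$-th $p\times p$ diagonal block $\nabla^2 f_i(\mathbf{x}_{i,t})$. Then $$\mathbf{D}_t:=\alpha\mathbf{G}_t+2(\mathbf{I}-\mathbf{Z}_d),\qquad \mathbf{B}:=\mathbf{I}-2\mathbf{Z}_d+\mathbf{Z},$$ so that the Hessian is $\nabla^2F(\mathbf{y}_t)=\mathbf{I}-\mathbf{Z}+\alpha\mathbf{G}_t=\mathbf{D}_t-\mathbf{B}$. The matrix $\mathbf{D}_t$ is positive definite. Constants (with $\delta,\Delta,m,M,L$ as in the hypotheses): $$\rho:=\frac{2(1-\delta)}{2(1-\delta)+\alpha m},\qquad \lambda:=\frac{1}{2(1-\delta)+\alpha M},\qquad \Lambda:=\frac{1-\rho^{K+1}}{(1-\rho)(2(1-\Delta)+\alpha m)} .$$ Stepsize: $$\epsilon:=\min\left\{1,\left[\frac{3m\lambda^{5/2}}{L\Lambda^{3}(F(\mathbf{y}_0)-F(\mathbf{y}^*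 ))^{1/2}}\right]^{1/2}\right\},$$ where the second entry is read as $+\infty$ if its denominator vanishes. Further, $0<\zeta<1$ is given by $$\zeta:=(2-\epsilon)\epsilon\alpha m\lambda-\frac{\alpha\epsilon^3L\Lambda^3(F(\mathbf{y}_0)-F(\mathbf{y}^* ))^{1/2}}{6\lambda^{3/2}},$$ and $$\Gamma_1:=\frac{(\alpha\epsilon L\Lambda)^{1/2}(F(\mathbf{y}_0)-F(\mathbf{y}^* ))^{1/4}}{\lambda^{3/4}(2(1-\Delta)+\alpha m)},\qquad \Gamma_2:=\frac{\alpha L\Lambda^2}{2\lambda(2(1-\Delta)+\alpha m)^{1/2}} .$$ Norms are Euclidean norms of vectors and the induced spectral norms of matrices. *)

(* Defs.v *)
From HB Require Import structures.
From mathcomp Require Import all_boot all_order all_algebra.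
From mathcomp Require Import mxtens.
From mathcomp Require Import all_classical all_reals all_analysis.

Set Implicit Arguments.
Unset Strict Implicit.
Unset Printing Implicit Defensive.

Import Order.TTheory GRing.Theory Num.Theory.
Import numFieldNormedType.Exports.

Local Open Scope classical_set_scope.
Local Open Scope ring_scope.

Section LinearAlgebra.
Context {R : realType}.

(* The library norm on matrices is the max norm, so the Euclidean and the
   induced spectral norm are introduced here. *)
Definition l2norm d (x : 'cV[R]_d) : R := Num.sqrt (\sum_(i < d) x i 0 ^+ 2).

Definition spectral_norm d (A : 'M[R]_d) : R :=
  sup [set l2norm (A *m x) | x in [set x : 'cV[R]_d | l2norm x <= 1]].

Definition psdmx d (A : 'M[R]_d) : Prop :=
  A^T = A /\ forall x : 'cV[R]_d, 0 <= (x^T *m A *m x) 0 0.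

Definition loewner_le d (A B : 'M[R]_d) : Prop := psdmx (B - A).

(* A positive semidefinite matrix has exactly one positive semidefinite square
   root; the value 0 is returned on matrices which have none. *)
Definition sqrtmx d (A : 'M[R]_d) : 'M[R]_d :=
  xget 0 [set S : 'M[R]_d | psdmx S /\ S *m S = A].

Definition invsqrtmx d (A : 'M[R]_d) : 'M[R]_d := invmx (sqrtmx A).

Definition diag_part d (A : 'M[R]_d) : 'M[R]_d := diag_mx (\row_i A i i).

End LinearAlgebra.

Section Calculus.
Context {R : realType}.

Definition grad d (f : 'cV[R]_d -> R) (x : 'cV[R]_d) : 'cV[R]_d :=
  \col_(i < d) 'D_(delta_mx i 0) (f : _ -> R^o) x.

Definition hessian d (f : 'cV[R]_d -> R) (x : 'cV[R]_d) : 'M[R]_d :=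
  \matrix_(i < d, j < d)
    'D_(delta_mx j 0) ((fun z => grad f z i 0) : 'cV[R]_d -> R^o) x.

(* Differentiability is Frechet differentiability. *)
Definition twice_differentiable d (f : 'cV[R]_d -> R) : Prop :=
  (forall x : 'cV[R]_d, differentiable (f : _ -> R^o) x) /\
  (forall x : 'cV[R]_d, differentiable (grad f) x).

Definition strongly_convex d (f : 'cV[R]_d -> R) : Prop :=
  exists2 mu : R, 0 < mu &
    forall (x y : 'cV[R]_d) (s : R), 0 <= s <= 1 ->
      f (s *: x + (1 - s) *: y) <=
        s * f x + (1 - s) * f y - mu / 2 * s * (1 - s) * l2norm (x - y) ^+ 2.

End Calculus.

Section Network.
Context {R : realType} (n : nat).

Record connected_network (e : rel 'I_n) : Prop := ConnectedNetwork {
  network_irrefl : irreflexive e;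
  network_sym : symmetric e;
  network_connected : forall i j, connect e i j
}.

Record weight_matrix (e : rel 'I_n) (W : 'M[R]_n) : Prop := WeightMatrix {
  weight_sparse : forall i j, j != i -> ~~ e i j -> W i j = 0;
  weight_sym : W^T = W;
  weight_ge0 : forall i j, 0 <= W i j;
  weight_stochastic : W *m (const_mx 1 : 'cV[R]_n) = const_mx 1;
  weight_null : forall v : 'cV[R]_n,
    (1%:M - W) *m v = 0 <-> exists c : R, v = c *: const_mx 1
}.

End Network.

Section PenalizedObjective.
Context {R : realType} (n p : nat).
Variables (alpha : R) (W : 'M[R]_n) (f : 'I_n -> 'cV[R]_p -> R).

(* Coordinate k of agent i sits at position mxtens_index (i, k) = i * p + k of
   a stacked vector, in agreement with the Kronecker product *t. *)
Definition block (y : 'cV[R]_(n * p)) (i : 'I_n) : 'cV[R]_p :=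
  \col_(k < p) y (mxtens_index (i, k)) 0.

Definition Zmx : 'M[R]_(n * p) := W *t (1%:M : 'M[R]_p).

Definition objective (y : 'cV[R]_(n * p)) : R :=
  2^-1 * (y^T *m (1%:M - Zmx) *m y) 0 0 + alpha * \sum_(i < n) f i (block y i).

Definition Gmx (y : 'cV[R]_(n * p)) : 'M[R]_(n * p) :=
  \matrix_(a, b)
    let: (i, k) := mxtens_unindex a in
    let: (j, l) := mxtens_unindex b in
    if i == j then hessian (f i) (block y i) k l else 0.

Definition Dmx (y : 'cV[R]_(n * p)) : 'M[R]_(n * p) :=
  alpha *: Gmx y + 2 *: (1%:M - diag_part Zmx).

Definition Bmx : 'M[R]_(n * p) := 1%:M - 2 *: diag_part Zmx + Zmx.

Definition nn_step (K : nat) (eps : R) (y : 'cV[R]_(n * p)) : 'cV[R]_(n * p) :=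
  let S := invsqrtmx (Dmx y) in
  y - eps *: (S *m (\sum_(k < K.+1) (S *m Bmx *m S) ^+ k) *m S
                *m grad objective y).

End PenalizedObjective.

Section Constants.
Context {R : realType}.
Variables (alpha m M L delta Delta : R) (K : nat).

Definition rho_cst : R := 2 * (1 - delta) / (2 * (1 - delta) + alpha * m).

Definition lambda_cst : R := (2 * (1 - delta) + alpha * M)^-1.

Definition Lambda_cst : R :=
  (1 - rho_cst ^+ K.+1) /
  ((1 - rho_cst) * (2 * (1 - Delta) + alpha * m)).

(* In the remaining definitions, gap stands for F(y_0) - min F. *)
Variable gap : R.

Definition stepsize : R :=
  let den := L * Lambda_cst ^+ 3 * Num.sqrt gap in
  if den == 0 then 1
  else Num.min 1 (Num.sqrt (3 * m * lambda_cst `^ (5 / 2) / den)).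

Definition zeta_cst : R :=
  (2 - stepsize) * stepsize * alpha * m * lambda_cst
  - alpha * stepsize ^+ 3 * L * Lambda_cst ^+ 3 * Num.sqrt gap
    / (6 * lambda_cst `^ (3 / 2)).

Definition Gamma1_cst : R :=
  Num.sqrt (alpha * stepsize * L * Lambda_cst) * gap `^ (1 / 4)
  / (lambda_cst `^ (3 / 4) * (2 * (1 - Delta) + alpha * m)).

Definition Gamma2_cst : R :=
  alpha * L * Lambda_cst ^+ 2
  / (2 * lambda_cst * Num.sqrt (2 * (1 - Delta) + alpha * m)).

Definition eta_seq (t : nat) : R :=
  (1 - stepsize + stepsize * rho_cst ^+ K.+1)
  * (1 + Gamma1_cst * (1 - zeta_cst) `^ ((t%:R - 1) / 4)).

End Constants.

(* Main.v *)
(** With P = D^(-1/2) B D^(-1/2) one has 0 <= P <= rho, and the NN-K direction v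
    satisfies D^(-1/2) (D - B) v = (1 - P^(K+1)) D^(-1/2) g.  Expanding the
    gradient at y_t hence gives, with d = 2 (1 - Delta) + alpha m,
      |D_t^(-1/2) g_(t+1)| <= (1 - eps + eps rho^(K+1)) |D_t^(-1/2) g_t|
                              + eps^2 Gamma_2 |D_(t-1)^(-1/2) g_t|^2,
    and trading D_t for D_(t-1) on the right costs a factor sqrt (1 + c) with
    c = alpha L |y_t - y_(t-1)| / d.  If sqrt (1 + c) <= 1 + s, where
    s = Gamma_1 (1 - zeta)^((t-1)/4), the linear term has factor eta_t and the
    lower bound assumed on |D_(t-1)^(-1/2) g_t| absorbs it in the quadratic one.

    Bounding c requires a rate for the gap F(y_t) - min F.  The rate 1 - zeta
    does not follow from the usual estimate: the descent inequality with the
    sharp bound |g|^2 <= (2 / lambda) gap loses a factor 2^(3/2) in the cubic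
    term of zeta.  Instead the Taylor remainder is bounded both by the cubic
    term in L and by the quadratic term in M - m.  Together they always give
    the rate sqrt (1 - zeta), and the rate 1 - zeta in the regime where the
    quadratic bound is the better one.  Since c only has to be at most
    2 s + s^2, the weak rate suffices (through 2 s) outside of that regime, and
    the strong one (through s^2) inside of it. *)

Require Import Defs.
From HB Require Import structures.
From mathcomp Require Import all_boot all_order all_algebra.
From mathcomp Require Import mxtens complex.
From mathcomp Require Import all_classical all_reals all_analysis.
From mathcomp Require Import ring lra.

Set Implicit Arguments.
Unset Strict Implicit.
Unset Printing Implicit Defensive.

Import Order.TTheory GRing.Theory Num.Theory.
Import numFieldNormedType.Exports.

Local Open Scope classical_set_scope.
Local Open Scope ring_scope.

(** * Euclidean vectors and positive semidefinite matrices *)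

Section Euclid.
Context {R : realType}.

Definition dotv d (x y : 'cV[R]_d) : R := (x^T *m y) 0 0.

Lemma dotvE d (x y : 'cV[R]_d) : dotv x y = \sum_i x i 0 * y i 0.
Proof. by rewrite /dotv mxE; apply: eq_bigr => i _; rewrite mxE. Qed.

Lemma dotvC d (x y : 'cV[R]_d) : dotv x y = dotv y x.
Proof. by rewrite !dotvE; apply: eq_bigr => i _; rewrite mulrC. Qed.

Lemma dotvDr d (x y z : 'cV[R]_d) : dotv x (y + z) = dotv x y + dotv x z.
Proof. by rewrite /dotv mulmxDr mxE. Qed.

Lemma dotvDl d (x y z : 'cV[R]_d) : dotv (x + y) z = dotv x z + dotv y z.
Proof. by rewrite dotvC dotvDr !(dotvC z). Qed.

Lemma dotvZr d a (x y : 'cV[R]_d) : dotv x (a *: y) = a * dotv x y.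
Proof. by rewrite /dotv -scalemxAr mxE. Qed.

Lemma dotvZl d a (x y : 'cV[R]_d) : dotv (a *: x) y = a * dotv x y.
Proof. by rewrite dotvC dotvZr dotvC. Qed.

Lemma dotvNr d (x y : 'cV[R]_d) : dotv x (- y) = - dotv x y.
Proof. by rewrite -scaleN1r dotvZr mulN1r. Qed.

Lemma dotvBr d (x y z : 'cV[R]_d) : dotv x (y - z) = dotv x y - dotv x z.
Proof. by rewrite dotvDr dotvNr. Qed.

Lemma dotv0r d (x : 'cV[R]_d) : dotv x 0 = 0.
Proof. by rewrite /dotv mulmx0 mxE. Qed.

Lemma dotv_mull d1 d2 (A : 'M[R]_(d1, d2)) x y :
  dotv (A *m x) y = dotv x (A^T *m y).
Proof. by rewrite /dotv trmx_mul mulmxA. Qed.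

Lemma dotv_ge0 d (x : 'cV[R]_d) : 0 <= dotv x x.
Proof. by rewrite dotvE sumr_ge0 // => i _; rewrite -expr2 sqr_ge0. Qed.

Lemma dotv_eq0 d (x : 'cV[R]_d) : dotv x x = 0 -> x = 0.
Proof.
rewrite dotvE => /psumr_eq0P x0; apply/colP => i; rewrite mxE.
have /eqP := x0 (fun i _ => sqr_ge0 (x i 0)) i isT.
by rewrite -expr2 sqrf_eq0 => /eqP.
Qed.

Lemma l2norm_ge0 d (x : 'cV[R]_d) : 0 <= l2norm x.
Proof. exact: sqrtr_ge0. Qed.

Lemma l2normE d (x : 'cV[R]_d) : l2norm x = Num.sqrt (dotv x x).
Proof.
by rewrite /l2norm dotvE; congr Num.sqrt; apply: eq_bigr => i _; rewrite expr2.
Qed.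

Lemma sqr_l2norm d (x : 'cV[R]_d) : l2norm x ^+ 2 = dotv x x.
Proof. by rewrite l2normE sqr_sqrtr // dotv_ge0. Qed.

Lemma ler_l2norm d (x : 'cV[R]_d) a :
  0 <= a -> dotv x x <= a ^+ 2 -> l2norm x <= a.
Proof.
by move=> a0 h; rewrite -(@ler_pXn2r _ 2) ?nnegrE ?l2norm_ge0 // sqr_l2norm.
Qed.

Lemma l2normZ d a (x : 'cV[R]_d) : l2norm (a *: x) = `|a| * l2norm x.
Proof.
by rewrite !l2normE dotvZl dotvZr mulrA -expr2 sqrtrM ?sqr_ge0 // sqrtr_sqr.
Qed.

Lemma eq_ler (x y : R) : x = y -> x <= y.
Proof. by move=> ->. Qed.

(** For positive [c] the vertex [s = - b / c] decides; for [c = 0] the expression is affine in [s],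
    which forces [b = 0]. *)
Lemma discriminant_le0 (a b c : R) :
  0 <= c -> (forall s, 0 <= a + 2 * s * b + s ^+ 2 * c) -> b ^+ 2 <= a * c.
Proof.
rewrite le_eqVlt => /predU1P[<- h|c0 h]; last first.
  have := h (- b / c).
  have -> : a + 2 * (- b / c) * b + (- b / c) ^+ 2 * c = (a * c - b ^+ 2) / c.
    by field; rewrite gt_eqF.
  by rewrite pmulr_lge0 ?invr_gt0 // subr_ge0.
rewrite mulr0; case: (eqVneq b 0) => [->|b0]; first by rewrite expr0n.
(* At this [s] the affine function takes the value -1. *)
have := h (- (a + 1) / (2 * b)); rewrite mulr0 addr0.
have -> : a + 2 * (- (a + 1) / (2 * b)) * b = -1 by field.
by rewrite ler0N1.
Qed.

Lemma psdmx_dotv d (A : 'M[R]_d) : psdmx A ->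
  forall x, 0 <= dotv x (A *m x).
Proof. by case=> _ A0 x; rewrite /dotv mulmxA. Qed.

Lemma psdmxP d (A : 'M[R]_d) :
  A^T = A -> (forall x, 0 <= dotv x (A *m x)) -> psdmx A.
Proof. by move=> At A0; split=> // x; rewrite -mulmxA; exact: A0. Qed.

Lemma psdmx_CauchySchwarz d (A : 'M[R]_d) x y : psdmx A ->
  dotv x (A *m y) ^+ 2 <= dotv x (A *m x) * dotv y (A *m y).
Proof.
move=> Apsd; have [At _] := Apsd.
apply: discriminant_le0 => [|s]; first exact: psdmx_dotv.
have := psdmx_dotv Apsd (x + s *: y).
rewrite mulmxDr -scalemxAr !dotvDl !dotvDr !dotvZl !dotvZr.
have -> : dotv y (A *m x) = dotv x (A *m y) by rewrite dotvC dotv_mull At.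
by congr (_ <= _); ring.
Qed.

Lemma CauchySchwarz d (x y : 'cV[R]_d) :
  dotv x y ^+ 2 <= dotv x x * dotv y y.
Proof.
have := @psdmx_CauchySchwarz d 1%:M x y; rewrite !mul1mx; apply.
by apply: psdmxP => [|z]; rewrite ?trmx1 // mul1mx dotv_ge0.
Qed.

Lemma dotv_le_l2norm d (x y : 'cV[R]_d) : dotv x y <= l2norm x * l2norm y.
Proof.
rewrite (le_trans (ler_norm _)) // -(@ler_pXn2r _ 2) ?nnegrE //.
  by rewrite exprMn !sqr_l2norm real_normK ?num_real // CauchySchwarz.
by rewrite mulr_ge0 ?l2norm_ge0.
Qed.

Lemma ler_l2normD d (x y : 'cV[R]_d) : l2norm (x + y) <= l2norm x + l2norm y.
Proof.
apply: ler_l2norm; first by rewrite addr_ge0 ?l2norm_ge0.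
rewrite dotvDl !dotvDr (dotvC y x) sqrrD !sqr_l2norm.
by have := dotv_le_l2norm x y; lra.
Qed.

(** In operator terms, A <= r implies A^2 <= r A. Cauchy-Schwarz for the form of [A] at x and Ax
    gives |Ax|^4 <= <x, Ax> <Ax, AAx> <= <x, Ax> r |Ax|^2, and |Ax|^2 is divided out. *)
Lemma psdmx_mulmx_le d (A : 'M[R]_d) r x : 0 <= r -> psdmx A ->
  (forall z, dotv z (A *m z) <= r * dotv z z) ->
  dotv (A *m x) (A *m x) <= r * dotv x (A *m x).
Proof.
move=> r0 Apsd Ar; have [At _] := Apsd.
have := psdmx_CauchySchwarz x (A *m x) Apsd; rewrite -{1}At -dotv_mull.
have := Ar (A *m x); have := psdmx_dotv Apsd x.
set b := dotv x _; set n := dotv (A *m x) (A *m x); set c := dotv _ (A *m _).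
move=> b0 cn nbc; have := dotv_ge0 (A *m x); rewrite -/n le_eqVlt.
case/predU1P => [<-|n0]; first by rewrite mulr_ge0.
rewrite -(ler_pM2r n0) -expr2 (le_trans nbc) //.
by rewrite [r * b]mulrC -mulrA ler_wpM2l.
Qed.

Lemma mulmx_inj_unitmx d (A : 'M[R]_d) :
  (forall x : 'cV_d, A *m x = 0 -> x = 0) -> A \in unitmx.
Proof.
move=> A0; rewrite -unitmx_tr -row_free_unit; apply/inj_row_free => v vA.
apply: trmx_inj; rewrite trmx0; apply: A0.
by rewrite -[LHS]trmxK trmx_mul trmxK vA trmx0.
Qed.

End Euclid.

(** * Diagonalization and square roots of positive semidefinite matrices *)

Section SquareRoot.
Context {R : realType}.

Lemma symmetric_diagonalizable d (A : 'M[R]_d) : A^T = A ->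
  exists P : 'M[R]_d, exists D : 'rV[R]_d,
    P \in unitmx /\ P *m A = diag_mx D *m P.
Proof.
(* The spectral theorem is available over closed fields only; a similarity over
   R[i] between two real matrices descends to R. *)
move=> At; pose toC : 'M[R]_d -> 'M[R[i]]_d := map_mx (real_complex R).
have realC (B : 'M[R]_d) : toC B \is a mxOver Num.real.
  by apply/mxOverP => i j; rewrite mxE; apply/complex_realP; exists (B i j).
have Aherm : toC A \is hermsymmx.
  apply: realsym_hermsym; last exact: realC.
  apply/is_hermitianmxP; rewrite expr0 scale1r; apply/matrixP => i j.
  by rewrite !mxE /= -{1}At mxE.
have s_real := hermitian_spectral_diag_real Aherm.
have /hermitian_normalmx/orthomx_spectralP := Aherm.
set P := spectralmx _; set s := spectral_diag _ in s_real * => AE.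
have Pu : P \in unitmx by exact: spectral_unit.
have [|||Q] := @real_similar _ _ (toC A) (diag_mx s).
- exists P => //; apply/similarP => //.
  by rewrite {1}AE !mulmxA mulmxV // mul1mx.
- exact: realC.
- apply/mxOverP => i j; rewrite mxE; case: (i == j); rewrite ?mulr1n ?mulr0n //.
  exact: (mxOverP s_real).
rewrite inE => /andP[Qreal Qu] /(similarP Qu) QA.
have reK m n (B : 'M[R[i]]_(m, n)) : B \is a mxOver Num.real ->
    map_mx (real_complex R) (map_mx (@complex.Re R) B) = B.
  move=> Br; apply/matrixP => i j; rewrite !mxE.
  by apply: RRe_real; exact: (mxOverP Br).
exists (map_mx (@complex.Re R) Q), (map_mx (@complex.Re R) s).
split; first by rewrite -(map_unitmx (real_complex R)) reK.
apply: (@map_mx_inj _ _ (real_complex R)).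
by rewrite !map_mxM map_diag_mx !reK.
Qed.

Lemma psdmx_sqrt_exists d (A : 'M[R]_d) : psdmx A ->
  exists S : 'M[R]_d, psdmx S /\ S *m S = A.
Proof.
move=> Apsd; have [At _] := Apsd.
have [P [D [Pu PA]]] := symmetric_diagonalizable At.
(* Row j of [P], transposed, is an eigenvector of [A] for [D 0 j]; it is nonzero because [P] is
   invertible. *)
have D0 j : 0 <= D 0 j.
  pose x := (row j P)^T.
  have xA : A *m x = D 0 j *: x.
    rewrite /x -[in LHS]At -trmx_mul -row_mul PA; apply/colP => k.
    rewrite !mxE (bigD1 j) //= big1 ?addr0 => [|i ij]; rewrite !mxE.
      by rewrite eqxx mulr1n.
    by rewrite eq_sym (negbTE ij) mulr0n mul0r.
  have := psdmx_dotv Apsd x; rewrite xA dotvZr.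
  have := dotv_ge0 x; rewrite le_eqVlt => /predU1P[/esym/dotv_eq0 x0|x0].
    have : row j P *m invmx P = 0.
      by rewrite -[row j P]trmxK -/x x0 trmx0 mul0mx.
    rewrite -row_mul mulmxV // => /rowP/(_ j); rewrite !mxE eqxx => /eqP.
    by rewrite oner_eq0.
  by rewrite pmulr_lge0.
pose s : 'rV[R]_d := \row_j Num.sqrt (Num.sqrt (D 0 j)).
(* P need not be orthogonal, but P P^T commutes with D, hence with s, and this is
   what makes T symmetric. *)
pose C := P *m P^T.
have DC : diag_mx D *m C = C *m diag_mx D.
  have PtD : P^T *m diag_mx D = A *m P^T.
    by rewrite -{1}[diag_mx D]tr_diag_mx -trmx_mul -PA trmx_mul At.
  by rewrite /C mulmxA -PA -[RHS]mulmxA PtD mulmxA.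
(* A nonzero entry (i, j) of [C] forces [D 0 i = D 0 j], hence equal entries of [s]. *)
have sC : diag_mx s *m C = C *m diag_mx s.
  apply/matrixP => i j; have /matrixP/(_ i j) := DC.
  rewrite !mul_diag_mx !mul_mx_diag !mxE; set c := \sum_k _.
  case: (eqVneq c 0) => [->|c0]; first by rewrite !mulr0 !mul0r.
  move=> Dc; have -> : D 0 i = D 0 j by apply: (mulIf c0); rewrite Dc mulrC.
  by rewrite mulrC.
pose T := invmx P *m diag_mx s *m P.
have Tt : T^T = T.
  have PTu : P^T \in unitmx by rewrite unitmx_tr.
  rewrite /T !trmx_mul tr_diag_mx trmx_inv.
  have : P *m (P^T *m (diag_mx s *m invmx P^T)) =
      P *m (invmx P *m diag_mx s *m P).
    rewrite !mulmxA mulmxV // mul1mx -/C -sC /C mulmxA -mulmxA.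
    by rewrite mulmxV // mulmx1.
  by move/(congr1 (mulmx (invmx P))); rewrite !mulKmx.
(* The entries of s are fourth roots, so that the square root is itself the
   square of a symmetric matrix, hence positive semidefinite. *)
exists (T *m T); split.
  apply: psdmxP => [|x]; first by rewrite trmx_mul Tt.
  by rewrite -mulmxA -{1}Tt -dotv_mull dotv_ge0.
have TT (E F : 'M[R]_d) :
    (invmx P *m E *m P) *m (invmx P *m F *m P) = invmx P *m (E *m F) *m P.
  by rewrite !mulmxA mulmxK.
have DE : D = \row_j (s 0 j * s 0 j * (s 0 j * s 0 j)).
  by apply/rowP => j; rewrite !mxE -!expr2 !sqr_sqrtr ?sqrtr_ge0.
have ssD : diag_mx s *m diag_mx s *m (diag_mx s *m diag_mx s) = diag_mx D.
  by rewrite !mulmx_diag DE; congr diag_mx; apply/rowP => j; rewrite !mxE.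
by rewrite !TT ssD -mulmxA -PA mulKmx.
Qed.

Lemma sqrtmxP d (A : 'M[R]_d) : psdmx A ->
  psdmx (sqrtmx A) /\ sqrtmx A *m sqrtmx A = A.
Proof.
move=> /psdmx_sqrt_exists[S SP]; rewrite /sqrtmx; case: xgetP => [T -> []//|h].
by have := h S; case.
Qed.

End SquareRoot.

(** * The truncated Newton direction *)

Section TruncatedNewton.
Context {R : realType} (N : nat).
Implicit Types x y g : 'cV[R]_N.
Variables (D B : 'M[R]_N) (dl nu rho : R) (K : nat).
Hypotheses (D_sym : D^T = D) (B_sym : B^T = B).
Hypotheses (dl_gt0 : 0 < dl) (rho_ge0 : 0 <= rho) (nu_ge0 : 0 <= nu).
Hypothesis D_ge : forall x, dl * dotv x x <= dotv x (D *m x).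
Hypothesis D_le : forall x, dotv x (D *m x) <= nu * dotv x x.
Hypothesis B_ge0 : forall x, 0 <= dotv x (B *m x).
Hypothesis B_le : forall x, dotv x (B *m x) <= rho * dotv x (D *m x).

Local Notation S := (sqrtmx D).
Local Notation T := (invsqrtmx D).
Local Notation P := (T *m B *m T).
Local Notation M := (\sum_(k < K.+1) P ^+ k).

Lemma D_psd : psdmx D.
Proof.
apply: psdmxP => // x; apply: le_trans (D_ge x).
by rewrite mulr_ge0 ?dotv_ge0 // ltW.
Qed.

Lemma sqrtmx_sym : S^T = S.
Proof. by have [[]] := sqrtmxP D_psd. Qed.

Lemma sqrtmx_sqr : S *m S = D.
Proof. by have [] := sqrtmxP D_psd. Qed.

Lemma dotv_sqrtmx x : dotv x (D *m x) = dotv (S *m x) (S *m x).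
Proof. by rewrite dotv_mull sqrtmx_sym mulmxA sqrtmx_sqr. Qed.

Lemma sqrtmx_unit : S \in unitmx.
Proof.
apply: mulmx_inj_unitmx => x Sx; apply: dotv_eq0; apply: le_anti.
rewrite dotv_ge0 andbT; have := D_ge x.
by rewrite dotv_sqrtmx Sx dotv0r pmulr_rle0.
Qed.

Lemma invsqrtmx_sym : T^T = T.
Proof. by rewrite /invsqrtmx trmx_inv sqrtmx_sym. Qed.

Lemma dotv_invsqrtmx x y : dotv (T *m x) y = dotv x (T *m y).
Proof. by rewrite dotv_mull invsqrtmx_sym. Qed.

Lemma sqrtmxK x : S *m (T *m x) = x.
Proof. by rewrite mulmxA mulmxV ?mul1mx // sqrtmx_unit. Qed.

Lemma invsqrtmxK x : T *m (S *m x) = x.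
Proof. by rewrite mulmxA mulVmx ?mul1mx // sqrtmx_unit. Qed.

Lemma mulmx_invsqrtmx x : D *m (T *m x) = S *m x.
Proof. by rewrite -[in RHS](sqrtmxK x) [RHS]mulmxA sqrtmx_sqr. Qed.

Lemma invsqrtmx_lower x : dotv x x <= nu * dotv (T *m x) (T *m x).
Proof. by have := D_le (T *m x); rewrite dotv_sqrtmx sqrtmxK. Qed.

Lemma invsqrtmx_upper x : dl * dotv (T *m x) (T *m x) <= dotv x x.
Proof. by have := D_ge (T *m x); rewrite dotv_sqrtmx sqrtmxK. Qed.

Lemma precond_sym : P^T = P.
Proof. by rewrite !trmx_mul invsqrtmx_sym B_sym mulmxA. Qed.

Lemma precond_psd : psdmx P.
Proof.
apply: psdmxP => [|x]; first exact: precond_sym.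
by rewrite -!mulmxA -dotv_invsqrtmx.
Qed.

Lemma precond_le x : dotv x (P *m x) <= rho * dotv x x.
Proof.
rewrite -!mulmxA -dotv_invsqrtmx (le_trans (B_le _)) //.
by rewrite dotv_sqrtmx sqrtmxK.
Qed.

Lemma precond_norm x : dotv (P *m x) (P *m x) <= rho ^+ 2 * dotv x x.
Proof.
apply: le_trans (psdmx_mulmx_le _ rho_ge0 precond_psd precond_le) _.
by rewrite expr2 -mulrA ler_wpM2l // precond_le.
Qed.

Lemma expmxS (A : 'M[R]_N) k x : A ^+ k.+1 *m x = A ^+ k *m (A *m x).
Proof. by rewrite exprSr -mulmxE mulmxA. Qed.

Lemma expmxSl (A : 'M[R]_N) k x : A ^+ k.+1 *m x = A *m (A ^+ k *m x).
Proof. by rewrite exprS -mulmxE mulmxA. Qed.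

Lemma precondX_norm k x : l2norm (P ^+ k *m x) <= rho ^+ k * l2norm x.
Proof.
elim: k x => [|k IH] x; first by rewrite !expr0 mul1mx mul1r.
rewrite expmxS (le_trans (IH _)) // exprSr -mulrA ler_wpM2l ?exprn_ge0 //.
apply: ler_l2norm; first by rewrite mulr_ge0 ?l2norm_ge0.
by rewrite exprMn sqr_l2norm precond_norm.
Qed.

(** Induction in steps of two: by symmetry of P, the form of P^(k+2) at z is that of P^k at Pz, and
    |Pz| <= rho |z|. The base cases are the identity and P. *)
Lemma precondX_bounds k x :
  0 <= dotv x (P ^+ k *m x) <= rho ^+ k * dotv x x.
Proof.
pose b j := forall z, 0 <= dotv z (P ^+ j *m z) <= rho ^+ j * dotv z z.
suff [] : b k /\ b k.+1 by [].
elim: k => [|k [bk bk1]]; split=> // z.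
- by rewrite !expr0 mul1mx mul1r dotv_ge0 lexx.
- by rewrite !expr1 (psdmx_dotv precond_psd) precond_le.
have -> : dotv z (P ^+ k.+2 *m z) = dotv (P *m z) (P ^+ k *m (P *m z)).
  by rewrite expmxSl expmxS [RHS]dotv_mull precond_sym.
have /andP[-> h] := bk (P *m z); rewrite (le_trans h) //.
by rewrite -addn2 exprD -mulrA ler_wpM2l ?exprn_ge0 // precond_norm.
Qed.

Lemma precondX_comm k l x y :
  dotv (P ^+ k *m x) (P ^+ l *m y) = dotv x (P ^+ (k + l) *m y).
Proof.
elim: k l x => [|k IH] l x; first by rewrite expr0 mul1mx add0n.
by rewrite expmxSl dotv_mull precond_sym -expmxSl IH addnS addSn.
Qed.

Let geom := \sum_(k < K.+1) rho ^+ k.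

Lemma series_mulmx x : M *m x = \sum_(k < K.+1) P ^+ k *m x.
Proof. exact: mulmx_suml. Qed.

Lemma dotv_sumr I (r : seq I) (Q : pred I) (F : I -> 'cV[R]_N) x :
  dotv x (\sum_(i <- r | Q i) F i) = \sum_(i <- r | Q i) dotv x (F i).
Proof.
by apply: (big_morph (dotv x)) => [y z|]; rewrite ?dotvDr ?dotv0r.
Qed.

(** The lower bound comes from the term k = 0, which is the identity, all other terms being
    nonnegative. *)
Lemma series_bounds x :
  dotv x x <= dotv x (M *m x) <= geom * dotv x x.
Proof.
rewrite series_mulmx dotv_sumr /geom mulr_suml; apply/andP; split; last first.
  by apply: ler_sum => k _; case/andP: (precondX_bounds k x).
rewrite big_ord_recl expr0 mul1mx lerDl sumr_ge0 // => k _.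
by case/andP: (precondX_bounds (lift ord0 k) x).
Qed.

Lemma series_sym : M^T = M.
Proof.
rewrite linear_sum; apply: eq_bigr => k _ /=.
elim: (k : nat) => [|j IH]; first by rewrite expr0; exact: trmx1.
by rewrite exprS -mulmxE trmx_mul IH precond_sym mulmxE -exprSr exprS.
Qed.

Lemma series_telescope x : M *m x - P *m (M *m x) = x - P ^+ K.+1 *m x.
Proof.
rewrite series_mulmx mulmx_sumr.
under [X in _ - X]eq_bigr do rewrite -expmxSl.
rewrite big_ord_recl [X in _ - X]big_ord_recr /= expr0 mul1mx.
by rewrite opprD addrA addrK.
Qed.

(** Since D - B = D^(1/2) (1 - P) D^(1/2), this is the inverse of D - B with the Neumann series of
    (1 - P)^-1 cut after degree K. *)
Definition newton_inv : 'M[R]_N := T *m M *m T.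

Lemma newton_invE g : newton_inv *m g = T *m (M *m (T *m g)).
Proof. by rewrite /newton_inv -!mulmxA. Qed.

Let Lambda := geom / dl.

Lemma geom_ge0 : 0 <= geom.
Proof. by apply: sumr_ge0 => k _; rewrite exprn_ge0. Qed.

Lemma newton_inv_sym : newton_inv^T = newton_inv.
Proof. by rewrite /newton_inv !trmx_mul invsqrtmx_sym series_sym mulmxA. Qed.

Lemma newton_inv_dotv g :
  dotv g (newton_inv *m g) = dotv (T *m g) (M *m (T *m g)).
Proof. by rewrite dotv_invsqrtmx newton_invE. Qed.

Lemma newton_inv_psd : psdmx newton_inv.
Proof.
apply: psdmxP newton_inv_sym _ => x; rewrite newton_inv_dotv.
by have /andP[h _] := series_bounds (T *m x); apply: le_trans h; apply: dotv_ge0.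
Qed.

Lemma newton_inv_lower g : dotv g g <= nu * dotv g (newton_inv *m g).
Proof.
rewrite (le_trans (invsqrtmx_lower g)) // ler_wpM2l // newton_inv_dotv.
by have /andP[] := series_bounds (T *m g).
Qed.

Lemma newton_inv_upper g : dotv g (newton_inv *m g) <= Lambda * dotv g g.
Proof.
rewrite newton_inv_dotv; have /andP[_ h] := series_bounds (T *m g).
rewrite (le_trans h) // /Lambda -mulrA ler_wpM2l ?geom_ge0 //.
by rewrite mulrC ler_pdivlMr // mulrC invsqrtmx_upper.
Qed.

Lemma Lambda_ge0 : 0 <= Lambda.
Proof. by rewrite divr_ge0 ?geom_ge0 // ltW. Qed.

Lemma newton_inv_sqr_le g :
  dotv (newton_inv *m g) (newton_inv *m g) <=
    Lambda * dotv g (newton_inv *m g).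
Proof.
apply: psdmx_mulmx_le Lambda_ge0 newton_inv_psd newton_inv_upper.
Qed.

Lemma newton_inv_norm g : l2norm (newton_inv *m g) <= Lambda * l2norm g.
Proof.
apply: ler_l2norm; first by rewrite mulr_ge0 ?l2norm_ge0 ?Lambda_ge0.
rewrite exprMn sqr_l2norm (le_trans (newton_inv_sqr_le g)) //.
by rewrite expr2 -mulrA ler_wpM2l ?Lambda_ge0 // newton_inv_upper.
Qed.

(** The outer square roots cancel and leave (1 - P) times the truncated series, which telescopes. *)
Lemma hessian_newton_inv g :
  T *m ((D - B) *m (newton_inv *m g)) = T *m g - P ^+ K.+1 *m (T *m g).
Proof.
rewrite -series_telescope mulmxBl mulmxBr.
by rewrite newton_invE mulmx_invsqrtmx invsqrtmxK !mulmxA.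
Qed.

(** With w = D^(-1/2) g the left side is <Mw, w - P^(K+1) w>, that is <w, Mw> minus a sum of terms
    <w, P^(k+K+1) w>, which are nonnegative. This keeps the second-order term of a step below eps^2
    / 2 times the decrement. *)
Lemma newton_inv_curvature g :
  dotv (newton_inv *m g) ((D - B) *m (newton_inv *m g)) <=
    dotv g (newton_inv *m g).
Proof.
rewrite {1}newton_invE dotv_invsqrtmx hessian_newton_inv newton_inv_dotv.
set w := T *m g; rewrite dotvBr (dotvC _ w) lerBlDr lerDl.
rewrite series_mulmx dotvC dotv_sumr sumr_ge0 // => k _.
by rewrite dotvC precondX_comm; case/andP: (precondX_bounds (k + K.+1) w).
Qed.

End TruncatedNewton.

(** * Stochastic weights and stacked vectors *)

Section InvsqrtCompare.
Context {R : realType} (N : nat).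
Variables (D D' : 'M[R]_N) (dl c : R).
Hypotheses (D_sym : D^T = D) (D'_sym : D'^T = D') (dl_gt0 : 0 < dl).
Hypothesis D_ge : forall x, dl * dotv x x <= dotv x (D *m x).
Hypothesis D'_ge : forall x, dl * dotv x x <= dotv x (D' *m x).
Hypothesis c_ge0 : 0 <= c.
Hypothesis D'_le : forall x, dotv x (D' *m x) <= c * dotv x (D *m x).

(** Inversion reverses the order of positive matrices. With z = D^-1 x, |D^(-1/2) x|^2 = <D'^(1/2)
    z, D'^(-1/2) x>, and |D'^(1/2) z|^2 <= c <z, D z> = c |D^(-1/2) x|^2; Cauchy-Schwarz
    concludes. *)
Lemma invsqrtmx_compare (x : 'cV[R]_N) :
  l2norm (invsqrtmx D *m x) <= Num.sqrt c * l2norm (invsqrtmx D' *m x).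
Proof.
set T := invsqrtmx D; set T' := invsqrtmx D'; pose z := T *m (T *m x).
have TxE : dotv (T *m x) (T *m x) = dotv (sqrtmx D' *m z) (T' *m x).
  rewrite [RHS]dotv_mull (sqrtmx_sym D'_sym dl_gt0 D'_ge).
  rewrite (sqrtmxK D'_sym dl_gt0 D'_ge) (dotv_invsqrtmx D_sym dl_gt0 D_ge).
  exact: dotvC.
have zE : l2norm (sqrtmx D' *m z) <= Num.sqrt c * l2norm (T *m x).
  apply: ler_l2norm; first by rewrite mulr_ge0 ?sqrtr_ge0 ?l2norm_ge0.
  rewrite -(dotv_sqrtmx D'_sym dl_gt0 D'_ge) (le_trans (D'_le z)) //.
  rewrite (dotv_sqrtmx D_sym dl_gt0 D_ge) (sqrtmxK D_sym dl_gt0 D_ge).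
  by rewrite exprMn sqr_sqrtr // sqr_l2norm.
have := l2norm_ge0 (T *m x); rewrite le_eqVlt => /predU1P[<-|T0].
  by apply: mulr_ge0; rewrite ?sqrtr_ge0 ?l2norm_ge0.
rewrite -(ler_pM2l T0) -expr2 sqr_l2norm TxE (le_trans (dotv_le_l2norm _ _)) //.
by rewrite mulrA ler_wpM2r ?l2norm_ge0 // mulrC.
Qed.

End InvsqrtCompare.

(** * Quadratic forms of symmetric stochastic matrices *)

Section Stochastic.
Context {R : realType} (n : nat) (W : 'M[R]_n).
Hypotheses (W_sym : W^T = W) (W_ge0 : forall i j, 0 <= W i j).
Hypothesis W_stoch : W *m (const_mx 1 : 'cV[R]_n) = const_mx 1.

Lemma stochastic_row i : \sum_j W i j = 1.
Proof.
have /colP/(_ i) := W_stoch; rewrite !mxE => <-.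
by apply: eq_bigr => j _; rewrite mxE mulr1.
Qed.

(** Expand the square; rows and, by symmetry, columns sum to 1. The sign s = -1 yields the Laplacian
    and s = 1 the form of 1 + W. *)
Lemma stochastic_sqr (u : 'I_n -> R) (s : R) : s ^+ 2 = 1 ->
  \sum_i \sum_j W i j * (u i + s * u j) ^+ 2 =
    2 * (\sum_i u i ^+ 2 + s * \sum_i \sum_j W i j * (u i * u j)).
Proof.
move=> s1; have W_col i : \sum_j W j i = 1.
  rewrite -[RHS](stochastic_row i); apply: eq_bigr => j _.
  by rewrite -[in LHS]W_sym mxE.
have e1 : \sum_i \sum_j W i j * u i ^+ 2 = \sum_i u i ^+ 2.
  by apply: eq_bigr => i _; rewrite -mulr_suml stochastic_row mul1r.
have e2 : \sum_i \sum_j W i j * u j ^+ 2 = \sum_i u i ^+ 2.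
  rewrite exchange_big; apply: eq_bigr => i _.
  by rewrite -mulr_suml W_col mul1r.
rewrite mulrDr mulr2n mulrDl mul1r -{1}e1 -{1}e2 mulrA mulr_sumr -!big_split /=.
apply: eq_bigr => i _; rewrite mulr_sumr -!big_split /=.
by apply: eq_bigr => j _; rewrite sqrrD exprMn s1; ring.
Qed.

Lemma stochastic_quad_le (u : 'I_n -> R) :
  \sum_i \sum_j W i j * (u i * u j) <= \sum_i u i ^+ 2.
Proof.
have := @stochastic_sqr u (-1); rewrite sqrrN expr1n => /(_ erefl) e.
have : 0 <= \sum_i \sum_j W i j * (u i + -1 * u j) ^+ 2.
  by apply: sumr_ge0 => i _; apply: sumr_ge0 => j _; rewrite mulr_ge0 ?sqr_ge0.
by rewrite e; lra.
Qed.

(** In the sum of squares for s = 1, the diagonal terms are 4 W_ii u_i^2 and the others are dropped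
    as nonnegative. This is what makes B positive semidefinite. *)
Lemma stochastic_quad_ge (u : 'I_n -> R) :
  2 * \sum_i W i i * u i ^+ 2 <=
    \sum_i u i ^+ 2 + \sum_i \sum_j W i j * (u i * u j).
Proof.
have := @stochastic_sqr u 1; rewrite expr1n => /(_ erefl) e.
have : 2 * (2 * \sum_i W i i * u i ^+ 2) <=
    \sum_i \sum_j W i j * (u i + 1 * u j) ^+ 2.
  rewrite !mulr_sumr; apply: ler_sum => i _; rewrite (bigD1 i) //= -[leLHS]addr0.
  apply: lerD; first by apply: eq_ler; ring.
  by apply: sumr_ge0 => j _; rewrite mulr_ge0 ?sqr_ge0.
by rewrite e; lra.
Qed.

End Stochastic.

(** * Stacked vectors, block matrices and the Kronecker product *)

Section Stacked.
Context {R : realType} (n p : nat).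
Implicit Types x y v : 'cV[R]_(n * p).

Lemma sum_mxtens (F : 'I_(n * p) -> R) :
  \sum_a F a = \sum_i \sum_k F (mxtens_index (i, k)).
Proof.
rewrite pair_bigA /= (reindex (@mxtens_index n p)) /=.
  by apply: eq_bigr => -[i k].
by exists (@mxtens_unindex n p) => a _; rewrite ?mxtens_indexK ?mxtens_unindexK.
Qed.

Lemma dotv_block x y : dotv x y = \sum_i dotv (block x i) (block y i).
Proof.
rewrite dotvE sum_mxtens; apply: eq_bigr => i _; rewrite dotvE.
by apply: eq_bigr => k _; rewrite !mxE.
Qed.

Definition stack (F : 'I_n -> 'cV[R]_p) : 'cV[R]_(n * p) :=
  \col_a F (mxtens_unindex a).1 (mxtens_unindex a).2 0.

Lemma block_stack F i : block (stack F) i = F i.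
Proof. by apply/colP => k; rewrite !mxE mxtens_indexK. Qed.

Lemma blockD x y i : block (x + y) i = block x i + block y i.
Proof. by apply/colP => k; rewrite !mxE. Qed.

Lemma blockZ a x i : block (a *: x) i = a *: block x i.
Proof. by apply/colP => k; rewrite !mxE. Qed.

Lemma blockB x y i : block (x - y) i = block x i - block y i.
Proof. by apply/colP => k; rewrite !mxE. Qed.

Lemma GmxE (f : 'I_n -> 'cV[R]_p -> R) x i j k l :
  Gmx f x (mxtens_index (i, k)) (mxtens_index (j, l)) =
    if i == j then hessian (f i) (block x i) k l else 0.
Proof. by rewrite mxE !mxtens_indexK. Qed.

Lemma block_Gmx (f : 'I_n -> 'cV[R]_p -> R) x v i :
  block (Gmx f x *m v) i = hessian (f i) (block x i) *m block v i.
Proof.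
apply/colP => k; rewrite [LHS]mxE [LHS]mxE [RHS]mxE sum_mxtens.
rewrite (bigD1 i) //= [X in _ + X]big1 ?addr0.
  by apply: eq_bigr => l _; rewrite GmxE eqxx [block v i l 0]mxE.
by move=> j ji; apply: big1 => l _; rewrite GmxE eq_sym (negbTE ji) mul0r.
Qed.

Lemma Gmx_quad (f : 'I_n -> 'cV[R]_p -> R) x v :
  dotv v (Gmx f x *m v) =
    \sum_i dotv (block v i) (hessian (f i) (block x i) *m block v i).
Proof. by rewrite dotv_block; apply: eq_bigr => i _; rewrite block_Gmx. Qed.

Variable W : 'M[R]_n.

(** W is tensored with an identity, so the form splits into one copy of the form of W for each
    coordinate k, and the scalar inequalities apply to each copy. *)
Lemma Zmx_quad v :
  dotv v (Zmx p W *m v) =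
    \sum_k \sum_i \sum_j W i j * (block v i k 0 * block v j k 0).
Proof.
rewrite dotvE sum_mxtens exchange_big; apply: eq_bigr => k _.
apply: eq_bigr => i _; rewrite mxE sum_mxtens mulr_sumr; apply: eq_bigr => j _.
rewrite (bigD1 k) //= big1 ?addr0 => [|l lk].
  by rewrite tensmxE !mxE eqxx /= mulr1n; ring.
by rewrite tensmxE mxE eq_sym (negbTE lk) mulr0 mul0r.
Qed.

Lemma block_diag_part v i :
  block (diag_part (Zmx p W) *m v) i = W i i *: block v i.
Proof.
apply/colP => k; rewrite [LHS]mxE mul_diag_mx mxE [X in X * _]mxE tensmxE.
by rewrite [X in _ * X * _]mxE eqxx mulr1 !mxE.
Qed.

Lemma diag_part_quad v :
  dotv v ((1%:M - diag_part (Zmx p W)) *m v) =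
    \sum_i (1 - W i i) * dotv (block v i) (block v i).
Proof.
rewrite dotv_block; apply: eq_bigr => i _.
by rewrite mulmxBl mul1mx blockB block_diag_part dotvBr dotvZr; ring.
Qed.

Lemma dotv_coord v : dotv v v = \sum_k \sum_i block v i k 0 ^+ 2.
Proof.
rewrite dotv_block exchange_big; apply: eq_bigr => i _; rewrite dotvE.
by apply: eq_bigr => k _; rewrite expr2.
Qed.

Hypotheses (W_sym : W^T = W) (W_ge0 : forall i j, 0 <= W i j).
Hypothesis W_stoch : W *m (const_mx 1 : 'cV[R]_n) = const_mx 1.

Lemma laplacian_ge0 v : 0 <= dotv v ((1%:M - Zmx p W) *m v).
Proof.
rewrite mulmxBl mul1mx dotvBr subr_ge0 Zmx_quad dotv_coord.
by apply: ler_sum => k _; apply: stochastic_quad_le.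
Qed.

Lemma Bmx_quad v :
  dotv v (Bmx p W *m v) =
    2 * dotv v ((1%:M - diag_part (Zmx p W)) *m v) -
    dotv v ((1%:M - Zmx p W) *m v).
Proof.
rewrite -dotvZr scalemxAl -dotvBr -mulmxBl; congr (dotv v (_ *m v)).
rewrite /Bmx scalerBr opprB; apply/matrixP => a b; rewrite !mxE; ring.
Qed.

Lemma Bmx_le v :
  dotv v (Bmx p W *m v) <= 2 * dotv v ((1%:M - diag_part (Zmx p W)) *m v).
Proof. by rewrite Bmx_quad; have := laplacian_ge0 v; lra. Qed.

Lemma Bmx_ge0 v : 0 <= dotv v (Bmx p W *m v).
Proof.
rewrite Bmx_quad diag_part_quad mulmxBl mul1mx dotvBr Zmx_quad.
have -> : \sum_i (1 - W i i) * dotv (block v i) (block v i) =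
    dotv v v - \sum_k \sum_i W i i * block v i k 0 ^+ 2.
  rewrite dotv_block exchange_big -sumrB; apply: eq_bigr => i _.
  rewrite mulrBl mul1r; congr (_ - _); rewrite dotvE mulr_sumr.
  by apply: eq_bigr => k _; rewrite expr2.
have : 2 * \sum_k \sum_i W i i * block v i k 0 ^+ 2 <= dotv v v +
    \sum_k \sum_i \sum_j W i j * (block v i k 0 * block v j k 0).
  rewrite mulr_sumr dotv_coord -big_split /=; apply: ler_sum => k _.
  exact: stochastic_quad_ge.
lra.
Qed.

Lemma Zmx_sym : (Zmx p W)^T = Zmx p W.
Proof. by rewrite /Zmx trmx_tens W_sym trmx1. Qed.

Lemma diag_part_sym d (A : 'M[R]_d) : (diag_part A)^T = diag_part A.
Proof. exact: tr_diag_mx. Qed.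

Lemma Bmx_sym : (Bmx p W)^T = Bmx p W.
Proof.
rewrite /Bmx !linearD /= !linearN /= !linearZ /= trmx1 diag_part_sym Zmx_sym.
by [].
Qed.

(** * Spectral bounds for G, D and the Hessian D - B *)

Variables (f : 'I_n -> 'cV[R]_p -> R) (alpha delta Delta m M : R).
Hypotheses (alpha_gt0 : 0 < alpha) (m_gt0 : 0 < m) (m_M : m <= M).
Hypothesis Delta_lt1 : Delta < 1.
Hypothesis W_diag : forall i, delta <= W i i <= Delta.
Hypothesis hess_bounds : forall i (z : 'cV[R]_p),
  loewner_le m%:M (hessian (f i) z) /\ loewner_le (hessian (f i) z) M%:M.

Lemma hess_sym i (x : 'cV[R]_p) : (hessian (f i) x)^T = hessian (f i) x.
Proof.
have [[+ _] _] := hess_bounds i x; rewrite linearB /= tr_scalar_mx.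
by move/addIr.
Qed.

Lemma hess_quad i (x v : 'cV[R]_p) :
  m * dotv v v <= dotv v (hessian (f i) x *m v) <= M * dotv v v.
Proof.
have [/psdmx_dotv/(_ v) h1 /psdmx_dotv/(_ v) h2] := hess_bounds i x.
move: h1 h2; rewrite !mulmxBl !mul_scalar_mx !dotvBr !dotvZr !subr_ge0.
by move=> -> ->.
Qed.

Lemma Gmx_sym x : (Gmx f x)^T = Gmx f x.
Proof.
apply/matrixP => a b; rewrite !mxE.
case: (mxtens_unindex a) => i k; case: (mxtens_unindex b) => j l.
rewrite eq_sym; case: eqP => // ->.
by have /matrixP/(_ l k) := hess_sym j (block x j); rewrite mxE.
Qed.

Lemma Gmx_bounds x v :
  m * dotv v v <= dotv v (Gmx f x *m v) <= M * dotv v v.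
Proof.
rewrite Gmx_quad dotv_block !mulr_sumr; apply/andP; split.
  by apply: ler_sum => i _; case/andP: (hess_quad i (block x i) (block v i)).
by apply: ler_sum => i _; case/andP: (hess_quad i (block x i) (block v i)).
Qed.

Lemma Dmx_sym x : (Dmx alpha W f x)^T = Dmx alpha W f x.
Proof.
by rewrite /Dmx linearD /= !linearZ /= linearB /= trmx1 diag_part_sym Gmx_sym.
Qed.

Lemma Dmx_quad x v :
  dotv v (Dmx alpha W f x *m v) = alpha * dotv v (Gmx f x *m v) +
    2 * dotv v ((1%:M - diag_part (Zmx p W)) *m v).
Proof.
by rewrite /Dmx [in LHS]mulmxDl dotvDr -2!scalemxAl !dotvZr.
Qed.

Lemma diag_part_bounds v :
  (1 - Delta) * dotv v v <= dotv v ((1%:M - diag_part (Zmx p W)) *m v)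
    <= (1 - delta) * dotv v v.
Proof.
rewrite diag_part_quad dotv_block !mulr_sumr; apply/andP.
by split; apply: ler_sum => i _; rewrite ler_wpM2r ?dotv_ge0 //;
  have := W_diag i; lra.
Qed.

Lemma Dmx_ge x v :
  (2 * (1 - Delta) + alpha * m) * dotv v v <= dotv v (Dmx alpha W f x *m v).
Proof.
rewrite Dmx_quad; have /andP[h1 _] := Gmx_bounds x v.
have /andP[h2 _] := diag_part_bounds v.
by rewrite -(ler_pM2l alpha_gt0) in h1; nra.
Qed.

Lemma Dmx_le x v :
  dotv v (Dmx alpha W f x *m v) <= (2 * (1 - delta) + alpha * M) * dotv v v.
Proof.
rewrite Dmx_quad; have /andP[_ h1] := Gmx_bounds x v.
have /andP[_ h2] := diag_part_bounds v.
by rewrite -(ler_pM2l alpha_gt0) in h1; nra.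
Qed.

Hypotheses (delta_Delta : delta <= Delta).

Lemma Bmx_le_Dmx x v :
  dotv v (Bmx p W *m v) <=
    rho_cst alpha m delta * dotv v (Dmx alpha W f x *m v).
Proof.
rewrite (le_trans (Bmx_le v)) // Dmx_quad /rho_cst.
have am0 : 0 < alpha * m by rewrite mulr_gt0.
have d1 : 0 < 1 - delta by rewrite subr_gt0 (le_lt_trans delta_Delta).
have c0 : 0 < 2 * (1 - delta) + alpha * m by lra.
rewrite mulrAC ler_pdivlMr //.
(* Without denominators and common terms the claim is alpha m <v, (1 - Z_d) v> <= (1 - delta) alpha
   <v, G v>; both sides are compared with (1 - delta) alpha m |v|^2. *)
have /andP[h1 _] := Gmx_bounds x v; have /andP[_ h2] := diag_part_bounds v.
rewrite -(ler_pM2l alpha_gt0) in h1; rewrite -(ler_pM2l am0) in h2.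
rewrite -(ler_pM2l d1) in h1.
nra.
Qed.

Lemma DmxB x :
  Dmx alpha W f x - Bmx p W = 1%:M - Zmx p W + alpha *: Gmx f x.
Proof.
rewrite /Dmx /Bmx; apply/matrixP => a b; rewrite !mxE; ring.
Qed.

Lemma hess_obj_ge x v :
  alpha * m * dotv v v <= dotv v ((Dmx alpha W f x - Bmx p W) *m v).
Proof.
rewrite DmxB mulmxDl dotvDr -scalemxAl dotvZr.
have /andP[h1 _] := Gmx_bounds x v; have := laplacian_ge0 v.
by rewrite -(ler_pM2l alpha_gt0) in h1; lra.
Qed.

Lemma hess_obj_le x v :
  dotv v ((Dmx alpha W f x - Bmx p W) *m v) <=
    (2 * (1 - delta) + alpha * M) * dotv v v.
Proof.
rewrite mulmxBl dotvBr; have := Bmx_ge0 v; have := Dmx_le x v; lra.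
Qed.

End Stacked.

(** * Derivatives and Taylor estimates *)

Section LineDerivatives.
Context {R : realType}.

Lemma is_derive_line_quotient (V : normedModType R) (F : V -> R^o)
    (x v : V) (s : R) :
  (fun h : R => h^-1 *: (((fun r : R => F (x + r *: v)) \o shift s)
                           (h *: (1 : R^o)) - F (x + s *: v))) =
  (fun h => h^-1 *: ((F \o shift (x + s *: v)) (h *: v) - F (x + s *: v))).
Proof.
apply/funext => h /=; congr (_ *: (F _ - _)).
by rewrite [h *: 1]mulr1 scalerDl addrC addrA addrAC; rewrite -!addrA addrC.
Qed.

Lemma is_derive_line (V : normedModType R) (F : V -> R^o) (x v : V) (s l : R) :
  is_derive (x + s *: v) v F l ->
  is_derive s 1 (fun r : R => F (x + r *: v) : R^o) l.
Proof.
move=> [dF Fl]; split.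
  by rewrite /derivable is_derive_line_quotient.
by rewrite -Fl /derive is_derive_line_quotient.
Qed.

Lemma derive_line (V : normedModType R) (F : V -> R^o) (x v : V) (l : R) :
  is_derive (0 : R) 1 (fun r : R => F (x + r *: v) : R^o) l -> 'D_v F x = l.
Proof.
move=> [_ <-]; rewrite /derive is_derive_line_quotient.
by rewrite scale0r addr0.
Qed.

(** The mean value theorem for g - f. In the Taylor estimates [g] is a polynomial, so comparison
    replaces integration and existence of the derivatives suffices. *)
Lemma derive_increments_le (f g df dg : R -> R) :
  (forall s : R, is_derive s 1 f (df s)) ->
  (forall s : R, is_derive s 1 g (dg s)) ->
  (forall s, 0 <= s <= 1 -> df s <= dg s) ->
  forall s, 0 <= s <= 1 -> f s - f 0 <= g s - g 0.
Proof.
move=> fd gd fg s /andP[s0 s1].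
have hd (r : R) : is_derive r 1 (g - f) (dg r - df r).
  exact: is_deriveB.
have [|c /[!in_itv]/= /andP[c0 cs]] := @MVT_segment R _ _ 0 s s0 (fun r _ => hd r).
  apply: continuous_subspaceT => r.
  have [dh _] := hd r; apply: differentiable_continuous.
  exact/derivable1_diffP.
rewrite subr0 !fctE => e.
have : 0 <= (dg c - df c) * s.
  by rewrite mulr_ge0 // subr_ge0 fg // c0 (le_trans cs).
by rewrite -e; lra.
Qed.

Lemma taylor1_le (h dh : R -> R) (a c : R) :
  (forall s : R, is_derive s 1 h (dh s)) ->
  (forall s, 0 <= s <= 1 -> dh s <= a + c * s) ->
  forall s, 0 <= s <= 1 -> h s <= h 0 + a * s + c / 2 * s ^+ 2.
Proof.
move=> hd hle s s01.
pose g := horner (a *: 'X + (c / 2) *: 'X^2).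
have gd (r : R) : is_derive r 1 g (a + c * r).
  apply: is_derive_eq; by rewrite !poly.derivE !hornerE /=; field.
have := derive_increments_le hd gd hle s01.
rewrite /g !hornerE /=; lra.
Qed.

Lemma taylor2_le (h dh ddh : R -> R) (a c : R) :
  (forall s : R, is_derive s 1 h (dh s)) ->
  (forall s : R, is_derive s 1 dh (ddh s)) ->
  (forall s, 0 <= s <= 1 -> ddh s <= a + c * s) ->
  h 1 <= h 0 + dh 0 + a / 2 + c / 6.
Proof.
move=> hd dhd hle.
have dhle := taylor1_le dhd hle.
pose g := horner (dh 0 *: 'X + (a / 2) *: 'X^2 + (c / 6) *: 'X^3).
have gd (r : R) : is_derive r 1 g (dh 0 + a * r + c / 2 * r ^+ 2).
  apply: is_derive_eq; by rewrite !poly.derivE !hornerE /=; field.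
have := derive_increments_le hd gd dhle (s := 1).
rewrite ler01 lexx => /(_ isT); rewrite /g !hornerE /=; lra.
Qed.

Lemma taylor2_ge (h dh ddh : R -> R) (a : R) :
  (forall s : R, is_derive s 1 h (dh s)) ->
  (forall s : R, is_derive s 1 dh (ddh s)) ->
  (forall s, 0 <= s <= 1 -> a <= ddh s) ->
  h 0 + dh 0 + a / 2 <= h 1.
Proof.
move=> hd dhd hge.
have hNd (s : R) : is_derive s 1 (- h) (- dh s) by exact: is_deriveN.
have dhNd (s : R) : is_derive s 1 (- dh) (- ddh s) by exact: is_deriveN.
have := @taylor2_le _ _ _ (- a) 0 hNd dhNd.
have hN s : 0 <= s <= 1 -> - ddh s <= - a + 0 * s.
  by move/hge; lra.
by move/(_ hN); rewrite !fctE; lra.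
Qed.

Lemma is_derive_grad d (f : 'cV[R]_d -> R) (z v : 'cV[R]_d) :
  differentiable (f : _ -> R^o) z ->
  is_derive z v (f : _ -> R^o) (dotv (grad f z) v).
Proof.
move=> fd; split; first exact: diff_derivable.
rewrite deriveE // {1}(_ : v = \sum_i v i 0 *: delta_mx i 0).
  rewrite linear_sum dotvE; apply: eq_bigr => i _.
  by rewrite linearZ /= mxE deriveE // mulrC.
by rewrite {1}[v]matrix_sum_delta; apply: eq_bigr => i _; rewrite big_ord1.
Qed.

Lemma is_derive_hessian d (f : 'cV[R]_d -> R) (c z v : 'cV[R]_d) :
  differentiable (grad f) z ->
  is_derive z v ((fun x => dotv c (grad f x)) : _ -> R^o)
    (dotv c (hessian f z *m v)).
Proof.
move=> fd.
have coord i : is_derive z v ((fun x => grad f x i 0) : _ -> R^o)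
    ((hessian f z *m v) i 0).
  have := @is_derive_grad _ (fun x => grad f x i 0) z v.
  have -> : dotv (grad (fun x => grad f x i 0) z) v = (hessian f z *m v) i 0.
    by rewrite dotvE mxE; apply: eq_bigr => j _; rewrite !mxE.
  apply; apply: (@differentiable_comp _ _ _ _ (grad f)
    (fun N : 'cV[R]_d => N i 0 : R^o)) => //.
  exact: differentiable_coord.
have := @is_derive_sum _ _ _ d
  (fun i => c i 0 *: ((fun x => grad f x i 0) : _ -> R^o)) z v
  (fun i => c i 0 *: (hessian f z *m v) i 0)
  (fun i => is_deriveZ _ (coord i)).
rewrite -[X in is_derive _ _ _ X]dotvE.
set F := \sum_(i < d) _; rewrite (_ : F = (fun x => dotv c (grad f x))) //.
by apply/funext => x; rewrite /F fct_sumE dotvE.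
Qed.

End LineDerivatives.

(** * Gradient and Hessian of the penalized objective along lines *)

Section ObjectiveDerivatives.
Context {R : realType} (n p : nat).
Variables (W : 'M[R]_n) (f : 'I_n -> 'cV[R]_p -> R) (alpha : R).
Hypothesis W_sym : W^T = W.
Hypothesis f_diff2 : forall i, twice_differentiable (f i).
Implicit Types y v c : 'cV[R]_(n * p).

Local Notation F := (objective alpha W f).
Local Notation A := (1%:M - Zmx p W).
Local Notation H y := (Dmx alpha W f y - Bmx p W).

Definition obj_grad y : 'cV[R]_(n * p) :=
  A *m y + alpha *: stack (fun i => grad (f i) (block y i)).

Lemma objectiveE y :
  F y = 2^-1 * dotv y (A *m y) + alpha * \sum_(i < n) f i (block y i).
Proof. by rewrite /objective /dotv mulmxA. Qed.

Lemma dotv_stack v (G : 'I_n -> 'cV[R]_p) :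
  dotv v (stack G) = \sum_i dotv (block v i) (G i).
Proof. by rewrite dotv_block; apply: eq_bigr => i _; rewrite block_stack. Qed.

Lemma block_line y v (s : R) i : block (y + s *: v) i = block y i + s *: block v i.
Proof. by rewrite blockD blockZ. Qed.

Lemma is_derive_sumf (g : 'I_n -> R -> R) (dg : 'I_n -> R) (s : R) :
  (forall i, is_derive s 1 (g i) (dg i)) ->
  is_derive s 1 (fun r => \sum_i g i r) (\sum_i dg i).
Proof.
move=> gd; have := @is_derive_sum _ _ _ n g s 1 dg gd.
set G := \sum_(i < n) g i; rewrite (_ : G = (fun r => \sum_i g i r)) //.
by apply/funext => r; rewrite /G fct_sumE.
Qed.

Lemma is_derive_objective y v (s : R) :
  is_derive s 1 (fun r => F (y + r *: v)) (dotv v (obj_grad (y + s *: v))).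
Proof.
have At : A^T = A by rewrite linearB /= trmx1 Zmx_sym.
pose q := horner ((2^-1 * dotv y (A *m y))%:P + dotv v (A *m y) *: 'X
  + (2^-1 * dotv v (A *m v)) *: 'X^2).
have qd : is_derive s 1 q (dotv v (A *m (y + s *: v))).
  apply: is_derive_eq; rewrite !poly.derivE !hornerE /=.
  by rewrite mulmxDr -scalemxAr dotvDr dotvZr; field.
have fd i : is_derive s 1 (fun r => f i (block y i + r *: block v i))
    (dotv (block v i) (grad (f i) (block y i + s *: block v i))).
  rewrite dotvC; apply: is_derive_line; apply: is_derive_grad.
  by have [] := f_diff2 i.
have := is_deriveD qd (is_deriveZ alpha (is_derive_sumf fd)).
set G := (_ + _ : R -> R) => Gd.
have -> : (fun r => F (y + r *: v)) = G.
  apply/funext => r; rewrite objectiveE /G !fctE /q !hornerE /=.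
  congr (_ + alpha * _); last by apply: eq_bigr => i _; rewrite block_line.
  have vy : dotv y (A *m v) = dotv v (A *m y) by rewrite dotvC dotv_mull At.
  rewrite mulmxDr -scalemxAr !dotvDl !dotvDr !dotvZl !dotvZr vy.
  by field.
apply: is_derive_eq Gd _; rewrite /obj_grad dotvDr dotvZr; congr (_ + alpha * _).
by rewrite dotv_stack; apply: eq_bigr => i _; rewrite block_line.
Qed.

Lemma grad_objective y : grad F y = obj_grad y.
Proof.
apply/colP => a; rewrite mxE; apply: derive_line.
have := is_derive_objective y (delta_mx a 0) 0; rewrite scale0r addr0.
move=> Gd; apply: is_derive_eq Gd _; rewrite dotvE (bigD1 a) //= big1 => [|b ba].
  by rewrite mxE !eqxx mul1r addr0.
by rewrite mxE (negbTE ba) mul0r.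
Qed.

(** The derivative of the gradient is D - B. Pairing with a fixed vector [c] makes it scalar, so
    that one-variable Taylor bounds apply. *)
Lemma is_derive_obj_grad c y v (s : R) :
  is_derive s 1 (fun r => dotv c (obj_grad (y + r *: v)))
    (dotv c (H (y + s *: v) *m v)).
Proof.
pose q := horner ((dotv c (A *m y))%:P + dotv c (A *m v) *: 'X).
have qd : is_derive s 1 q (dotv c (A *m v)).
  by apply: is_derive_eq; rewrite !poly.derivE !hornerE /=; field.
have fd i : is_derive s 1
    (fun r => dotv (block c i) (grad (f i) (block y i + r *: block v i)))
    (dotv (block c i) (hessian (f i) (block y i + s *: block v i) *m block v i)).
  apply: (@is_derive_line _ _ (fun x => dotv (block c i) (grad (f i) x))).
  apply: is_derive_hessian.
  by have [] := f_diff2 i.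
have := is_deriveD qd (is_deriveZ alpha (is_derive_sumf fd)).
set G := (_ + _ : R -> R) => Gd.
have -> : (fun r => dotv c (obj_grad (y + r *: v))) = G.
  apply/funext => r; rewrite /obj_grad /G !fctE /q !hornerE /=.
  rewrite dotvDr dotvZr mulmxDr -scalemxAr dotvDr dotvZr dotv_stack.
  congr (_ + _ + alpha * _); first exact: mulrC.
  by apply: eq_bigr => i _; rewrite block_line.
apply: is_derive_eq Gd _; rewrite DmxB [in RHS]mulmxDl dotvDr -scalemxAl dotvZr.
congr (_ + alpha * _); rewrite dotv_block; apply: eq_bigr => i _.
by rewrite block_Gmx block_line.
Qed.

End ObjectiveDerivatives.

(** * The spectral norm as an operator norm *)

Section SpectralNorm.
Context {R : realType}.

Lemma l2norm0 d : l2norm (0 : 'cV[R]_d) = 0.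
Proof. by rewrite l2normE dotv0r sqrtr0. Qed.

(** Cauchy-Schwarz on each row. It shows that the set whose supremum is the spectral norm is
    bounded. *)
Lemma frobenius_bound d (A : 'M[R]_d) (x : 'cV[R]_d) :
  dotv (A *m x) (A *m x) <= (\sum_i \sum_j A i j ^+ 2) * dotv x x.
Proof.
rewrite dotvE mulr_suml; apply: ler_sum => i _; rewrite -expr2.
have := CauchySchwarz (row i A)^T x; rewrite -/(dotv _ _).
have -> : dotv (row i A)^T x = (A *m x) i 0.
  by rewrite dotvE mxE; apply: eq_bigr => j _; rewrite !mxE.
have -> : dotv (row i A)^T (row i A)^T = \sum_j A i j ^+ 2.
  by rewrite dotvE; apply: eq_bigr => j _; rewrite !mxE expr2.
by [].
Qed.

Lemma spectral_norm_bound d (A : 'M[R]_d) (x : 'cV[R]_d) :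
  l2norm (A *m x) <= spectral_norm A * l2norm x.
Proof.
have sup_ub : has_ubound
    [set l2norm (A *m z) | z in [set z : 'cV[R]_d | l2norm z <= 1]].
  exists (Num.sqrt (\sum_i \sum_j A i j ^+ 2)) => _ [z /= z1 <-].
  have S0 : 0 <= \sum_i \sum_j A i j ^+ 2.
    by apply: sumr_ge0 => i _; apply: sumr_ge0 => j _; rewrite sqr_ge0.
  apply: ler_l2norm; rewrite ?sqrtr_ge0 // sqr_sqrtr //.
  rewrite (le_trans (frobenius_bound A z)) // -[leRHS]mulr1 ler_wpM2l //.
  by rewrite -sqr_l2norm expr_le1 ?l2norm_ge0.
have := l2norm_ge0 x; rewrite le_eqVlt => /predU1P[x0|x0].
  have -> : x = 0 by apply: dotv_eq0; rewrite -sqr_l2norm -x0 expr0n.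
  by rewrite mulmx0 l2norm0 mulr0.
rewrite -ler_pdivrMr // mulrC -[_^-1]gtr0_norm ?invr_gt0 // -l2normZ scalemxAr.
apply: sup_upper_bound; last first.
  exists ((l2norm x)^-1 *: x) => //=.
  by rewrite l2normZ gtr0_norm ?invr_gt0 // mulVf ?gt_eqF.
split=> //; exists (l2norm (A *m 0)); exists 0 => //=.
by rewrite l2norm0.
Qed.

Lemma spectral_norm_quad d (A : 'M[R]_d) (x y : 'cV[R]_d) :
  dotv x (A *m y) <= spectral_norm A * (l2norm x * l2norm y).
Proof.
rewrite (le_trans (dotv_le_l2norm _ _)) // mulrCA ler_wpM2l ?l2norm_ge0 //.
exact: spectral_norm_bound.
Qed.

End SpectralNorm.

Lemma scaler_addrB (R : pzRingType) (V : lmodType R) (a : R) (g g' u b : V) :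
  a *: g + u - b - (a *: g' + u - b) = a *: (g - g').
Proof. by rewrite opprB addrA subrK opprD addrACA subrr addr0 scalerBr. Qed.

(** * Taylor, smoothness and strong convexity estimates for the objective *)

Section ObjectiveEstimates.
Context {R : realType} (n p : nat).
Variables (W : 'M[R]_n) (f : 'I_n -> 'cV[R]_p -> R).
Variables (alpha delta Delta m M L : R).
Hypotheses (W_sym : W^T = W) (W_ge0 : forall i j, 0 <= W i j).
Hypothesis W_stoch : W *m (const_mx 1 : 'cV[R]_n) = const_mx 1.
Hypothesis f_diff2 : forall i, twice_differentiable (f i).
Hypotheses (alpha_gt0 : 0 < alpha) (m_gt0 : 0 < m).
Hypotheses (delta_Delta : delta <= Delta) (Delta_lt1 : Delta < 1).
Hypothesis W_diag : forall i, delta <= W i i <= Delta.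
Hypothesis hess_bounds : forall i (z : 'cV[R]_p),
  loewner_le m%:M (hessian (f i) z) /\ loewner_le (hessian (f i) z) M%:M.
Hypothesis L_gt0 : 0 < L.
Hypothesis hess_lipschitz : forall i (z z' : 'cV[R]_p),
  spectral_norm (hessian (f i) z - hessian (f i) z') <= L * l2norm (z - z').
Implicit Types x y v c : 'cV[R]_(n * p).

Local Notation F := (objective alpha W f).
Local Notation H y := (Dmx alpha W f y - Bmx p W).
Local Notation g := (obj_grad W f alpha).
Local Notation nu := (2 * (1 - delta) + alpha * M).

Lemma block_l2norm_le x i : l2norm (block x i) <= l2norm x.
Proof.
apply: ler_l2norm (l2norm_ge0 _) _; rewrite sqr_l2norm dotv_block.
by rewrite (bigD1 i) //= lerDl sumr_ge0 // => j _; rewrite dotv_ge0.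
Qed.

Lemma block_CauchySchwarz c v :
  \sum_i l2norm (block c i) * l2norm (block v i) <= l2norm c * l2norm v.
Proof.
have nrm (w : 'cV[R]_(n * p)) : l2norm (\col_i l2norm (block w i)) = l2norm w.
  rewrite !l2normE dotvE dotv_block; congr Num.sqrt; apply: eq_bigr => i _.
  by rewrite !mxE -expr2 sqr_l2norm.
rewrite -[X in X * _]nrm -[X in _ * X]nrm (le_trans _ (dotv_le_l2norm _ _)) //.
by rewrite dotvE; apply: ler_sum => i _; rewrite !mxE.
Qed.

(** G is block diagonal: each block moves by at most L |x - x'|, and Cauchy-Schwarz on the vectors
    of block norms sums the contributions. *)
Lemma Gmx_lipschitz x x' c v :
  dotv c ((Gmx f x - Gmx f x') *m v) <=
    L * l2norm (x - x') * (l2norm c * l2norm v).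
Proof.
have -> : dotv c ((Gmx f x - Gmx f x') *m v) =
    \sum_i dotv (block c i) ((hessian (f i) (block x i) -
                              hessian (f i) (block x' i)) *m block v i).
  rewrite dotv_block; apply: eq_bigr => i _.
  congr (dotv _ _); rewrite 2!mulmxBl blockB; congr (_ - _); exact: block_Gmx.
apply: le_trans (ler_wpM2l _ (block_CauchySchwarz c v)); last first.
  by rewrite mulr_ge0 ?l2norm_ge0 // ltW.
rewrite mulr_sumr; apply: ler_sum => i _.
rewrite (le_trans (spectral_norm_quad _ _ _)) // ler_wpM2r //.
  by rewrite mulr_ge0 ?l2norm_ge0.
rewrite (le_trans (hess_lipschitz _ _ _)) // ler_wpM2l ?(ltW L_gt0) //.
by rewrite -blockB block_l2norm_le.
Qed.

Lemma hess_obj_diff x x' c v :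
  dotv c (H x *m v) - dotv c (H x' *m v) =
    alpha * dotv c ((Gmx f x - Gmx f x') *m v).
Proof.
rewrite -dotvBr -mulmxBl -dotvZr scalemxAl; congr (dotv c (_ *m v)).
exact: scaler_addrB.
Qed.

Lemma hess_obj_line c y v (s : R) : 0 <= s ->
  dotv c (H (y + s *: v) *m v) <=
    dotv c (H y *m v) + alpha * L * l2norm c * l2norm v ^+ 2 * s.
Proof.
move=> s0; rewrite -lerBlDl (hess_obj_diff (y + s *: v) y c v).
have := Gmx_lipschitz (y + s *: v) y c v; rewrite -(ler_pM2l alpha_gt0).
rewrite [y + s *: v]addrC addrK l2normZ ger0_norm // => h.
apply: le_trans h _; apply: eq_ler; ring.
Qed.

Lemma objective_cubic_le y v :
  F (y + v) <= F y + dotv v (g y) + dotv v (H y *m v) / 2 +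
    alpha * L * l2norm v ^+ 3 / 6.
Proof.
have := taylor2_le (is_derive_objective alpha W_sym f_diff2 y v)
  (is_derive_obj_grad W alpha f_diff2 v y v)
  (fun s hs => hess_obj_line v y v (proj1 (andP hs))).
by rewrite scale1r scale0r addr0 [l2norm v ^+ 3]exprS !mulrA.
Qed.

(** Only alpha G varies along the segment, and m <= G <= M, so the curvature exceeds its initial
    value by at most alpha (M - m) |v|^2. *)
Lemma objective_quad_le y v :
  F (y + v) <= F y + dotv v (g y) +
    (dotv v (H y *m v) + alpha * (M - m) * dotv v v) / 2.
Proof.
have hle s : 0 <= s <= 1 -> dotv v (H (y + s *: v) *m v) <=
    (dotv v (H y *m v) + alpha * (M - m) * dotv v v) + 0 * s.
  move=> _; rewrite mul0r addr0 -lerBlDl (hess_obj_diff (y + s *: v) y v v) -mulrA.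
  rewrite ler_pM2l // (mulmxBl (Gmx f (y + s *: v)) (Gmx f y) v) dotvBr.
  have /andP[_ h1] := Gmx_bounds hess_bounds (y + s *: v) v.
  have /andP[h2 _] := Gmx_bounds hess_bounds y v.
  by rewrite [leRHS]mulrBl; exact: lerB h1 h2.
have := taylor2_le (is_derive_objective alpha W_sym f_diff2 y v)
  (is_derive_obj_grad W alpha f_diff2 v y v) hle.
by rewrite scale1r scale0r addr0; lra.
Qed.

Lemma objective_smooth y v :
  F (y + v) <= F y + dotv v (g y) + nu * dotv v v / 2.
Proof.
have hle s : 0 <= s <= 1 -> dotv v (H (y + s *: v) *m v) <= nu * dotv v v + 0 * s.
  by move=> _; rewrite mul0r addr0; apply: hess_obj_le.
have := taylor2_le (is_derive_objective alpha W_sym f_diff2 y v)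
  (is_derive_obj_grad W alpha f_diff2 v y v) hle.
by rewrite scale1r scale0r addr0; lra.
Qed.

Lemma objective_strong y v :
  F y + dotv v (g y) + alpha * m * dotv v v / 2 <= F (y + v).
Proof.
have hge s : 0 <= s <= 1 -> alpha * m * dotv v v <= dotv v (H (y + s *: v) *m v).
  by move=> _; apply: hess_obj_ge.
have := taylor2_ge (is_derive_objective alpha W_sym f_diff2 y v)
  (is_derive_obj_grad W alpha f_diff2 v y v) hge.
by rewrite scale1r scale0r addr0; lra.
Qed.

Variable ystar : 'cV[R]_(n * p).
Hypothesis ystar_argmin : forall z, F ystar <= F z.

(** Strong convexity towards [ystar], completed to the square |alpha m v + g|^2 >= 0. *)
Lemma gap_le_grad y : 2 * (alpha * m) * (F y - F ystar) <= dotv (g y) (g y).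
Proof.
have mu0 : 0 < alpha * m by rewrite mulr_gt0.
set v := ystar - y; have := objective_strong y v.
rewrite (_ : y + v = ystar); last by rewrite addrC subrK.
move: (g y) (F y) (F ystar) => gy a b h; have := dotv_ge0 (alpha * m *: v + gy).
rewrite !dotvDr !dotvDl !dotvZl !dotvZr (dotvC gy v).
nra.
Qed.

(** A gradient step of length 1 / nu lowers F by at least |g|^2 / (2 nu) and cannot go below the
    minimum. *)
Lemma grad_le_gap y : 0 < nu -> dotv (g y) (g y) <= 2 * nu * (F y - F ystar).
Proof.
move=> nu0; have := objective_smooth y (- nu^-1 *: g y).
have := ystar_argmin (y + - nu^-1 *: g y).
rewrite !dotvZl !dotvZr; set e := dotv _ _.
rewrite (_ : nu * _ / 2 = nu^-1 * e / 2); last by field; rewrite gt_eqF.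
move=> h1 h2; have {h1 h2} : nu^-1 * e <= 2 * (F y - F ystar) by lra.
by rewrite mulrC ler_pdivrMr // mulrAC.
Qed.

(** The remainder r is tested against itself: the scalar Taylor bound for <r, g(y + s v)> gives
    |r|^2 <= |r| alpha L |v|^2 / 2. *)
Lemma obj_grad_remainder y v :
  l2norm (g (y + v) - g y - H y *m v) <= alpha * L / 2 * l2norm v ^+ 2.
Proof.
have [r rd] : exists r, r = g (y + v) - g y - H y *m v by eexists.
rewrite -rd; have := l2norm_ge0 r; rewrite le_eqVlt.
have aL : 0 <= alpha * L / 2 by rewrite divr_ge0 ?mulr_ge0 ?ltW.
case/predU1P => [<-|r0]; first by rewrite mulr_ge0 ?sqr_ge0.
have := taylor1_le (is_derive_obj_grad W alpha f_diff2 r y v)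
  (fun s hs => hess_obj_line r y v (proj1 (andP hs))) (s := 1).
rewrite ler01 lexx => /(_ isT); rewrite scale1r scale0r addr0 => h.
have rE : dotv r r = dotv r (g (y + v)) - dotv r (g y) - dotv r (H y *m v).
  by rewrite -(dotvBr r (g (y + v))) -(dotvBr r (g (y + v) - g y)) -rd.
rewrite -(ler_pM2l r0) -expr2 (sqr_l2norm r) rE 2!lerBlDl (le_trans h) //.
rewrite -addrA lerD2l mulr1 lerD2l expr1n mulr1.
by apply: eq_ler; ring.
Qed.

End ObjectiveEstimates.

(** * Scalar inequalities for the rate *)

Section Rates.
Context {R : realType}.
Implicit Types ep u ka Q z N : R.

(* Dimensionless variables for one step with stepsize ep from a point with gap G
   and squared Newton decrement q = g^T v: ka = alpha m lambda,
   Q = Lambda / lambda, u is the ratio of ep^2 to its cap in the definition of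
   the stepsize, z = q / (2 ka G), and N is the Taylor remainder divided by
   ep ka G.  In these variables zeta = ep ka (2 - ep - u / 2), and the gap is
   multiplied by at most 1 - ep ka ((2 - ep) z - N). *)

Lemma zeta_bounds ep u ka : 0 < ep -> ep <= 1 -> 0 <= u -> u <= 1 ->
  0 < ka -> ka <= 1 -> 0 <= ep * ka * (2 - ep - u / 2) <= 1.
Proof.
move=> ep_gt0 ep_le1 u_ge0 u_le1 ka_gt0 ka_le1.
apply/andP; split; first by rewrite !mulr_ge0 ?ltW //; lra.
have h : ep * (2 - ep - u / 2) <= 1 by nra.
have h0 : 0 <= ep * (2 - ep - u / 2) by rewrite mulr_ge0 ?ltW //; lra.
rewrite mulrAC; nra.
Qed.

Lemma ler_sqr_sqrt (x y : R) : x ^+ 2 <= y -> x <= Num.sqrt y.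
Proof.
by move=> xy; rewrite (le_trans (ler_norm x)) // -sqrtr_sqr ler_wsqrtr.
Qed.

(** Here N <= (u / 2) z, so the right side is at least (2 - ep - u / 2) z, and z >= 1. *)
Lemma rate_quad ep u Q z N : ep <= 1 -> u <= 1 -> 1 <= z ->
  N <= ep * (Q - 1) * z -> 2 * ep * (Q - 1) <= u ->
  2 - ep - u / 2 <= (2 - ep) * z - N.
Proof.
move=> ep_le1 u_le1 z_ge1 N_quad h.
have h1 : (2 - ep - u / 2) * 1 <= (2 - ep - ep * (Q - 1)) * z.
  by apply: ler_pM => //; lra.
lra.
Qed.

Lemma rate_cubic ep u ka Q z N : ep <= 1 -> 0 <= u -> u <= 1 ->
  0 < ka -> 1 <= Q -> 1 <= z -> ka * z <= Q -> 0 <= N ->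
  N ^+ 2 * Q ^+ 3 <= 2 * u ^+ 2 * (ka * z) ^+ 3 -> 2 * ka <= Q ->
  2 - ep - u / 2 <= (2 - ep) * z - N.
Proof.
move=> ep_le1 u_ge0 u_le1 ka_gt0 Q_ge1 z_ge1 kaz N_ge0 N_cubic kaQ.
have Q3 : 0 < Q ^+ 3 by rewrite exprn_gt0 //; lra.
(* The gain (2 - ep)(z - 1) from a large decrement pays for z - 1 because ep <= 1. *)
suff h : N <= u / 2 + (z - 1) by nra.
have rhs0 : 0 <= u / 2 + (z - 1) by lra.
rewrite -(@ler_pXn2r _ 2) ?nnegrE //.
(* For z <= 2, ka / Q <= 1 / 2 gives N^2 <= u^2 z^3 / 4, and z^3 <= (2 z - 1)^2. For z > 2, ka z <=
   Q gives N^2 <= 2 u^2, which is below (u / 2 + 1)^2. *)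
case: (lerP z 2) => z2.
  have : N ^+ 2 * Q ^+ 3 <= u ^+ 2 * z ^+ 3 / 4 * Q ^+ 3.
    apply: le_trans N_cubic _; have : (2 * ka) ^+ 3 <= Q ^+ 3.
      by rewrite ler_pXn2r ?nnegrE //; lra.
    have : 0 <= u ^+ 2 * z ^+ 3 by rewrite mulr_ge0 ?exprn_ge0 //; lra.
    by rewrite !exprMn; nra.
  rewrite ler_pM2r // => /le_trans; apply.
  have : (u * (1 + 2 * (z - 1)) / 2) ^+ 2 <= (u / 2 + (z - 1)) ^+ 2.
    by rewrite ler_pXn2r ?nnegrE //; nra.
  apply: le_trans; have z3 : z ^+ 3 <= (1 + 2 * (z - 1)) ^+ 2.
    rewrite -subr_ge0 (_ : _ - _ = (z - 1) + (z - 1) ^+ 2 * (2 - z)); last by ring.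
    by rewrite addr_ge0 ?mulr_ge0 ?sqr_ge0 //; lra.
  have := ler_wpM2l (sqr_ge0 u) z3; lra.
have : N ^+ 2 * Q ^+ 3 <= 2 * u ^+ 2 * Q ^+ 3.
  apply: le_trans N_cubic _; rewrite ler_wpM2l //; first by have := sqr_ge0 u; lra.
  by rewrite ler_pXn2r ?nnegrE //; nra.
rewrite ler_pM2r // => /le_trans; apply; nra.
Qed.

Lemma rate_mixed ep u ka Q z N : 0 < ep -> ep <= 1 -> 0 <= u -> u <= 1 ->
  0 < ka -> ka <= 1 -> 1 <= Q -> 1 <= z -> ka * z <= Q -> 0 <= N ->
  N ^+ 2 * Q ^+ 3 <= 2 * u ^+ 2 * (ka * z) ^+ 3 ->
  N <= ep * (Q - 1) * z -> Q <= 2 * ka ->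
  2 - ep - Num.sqrt (ep * u / 2) <= (2 - ep) * z - N.
Proof.
move=> ep_gt0 ep_le1 u_ge0 u_le1 ka_gt0 ka_le1 Q_ge1 z_ge1 kaz N_ge0 N_cubic.
move=> N_quad kaQ; have Q3 : 0 < Q ^+ 3 by rewrite exprn_gt0 //; lra.
set E0 := Num.sqrt _; have E0_ge0 : 0 <= E0 by exact: sqrtr_ge0.
have E0_sqr : E0 ^+ 2 = ep * u / 2 by rewrite sqr_sqrtr // !mulr_ge0 // ltW.
set c := Num.sqrt (2 : R); have c0 : 0 <= c by exact: sqrtr_ge0.
have c2 : c ^+ 2 = 2 by rewrite sqr_sqrtr.
have c14 : 14 / 10 <= c by nra.
have z0 : 0 <= z by lra.
have z2 : z <= 2 by rewrite -(ler_pM2l ka_gt0); lra.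
(* N^4 is at most the product of the squares of the two bounds on N. *)
have N4 : N ^+ 4 <= E0 ^+ 4 * z ^+ 5.
  have h1 : N ^+ 2 * Q ^+ 3 <= 2 * u ^+ 2 * z ^+ 3.
    apply: le_trans N_cubic _; rewrite ler_wpM2l //; first by have := sqr_ge0 u; lra.
    by apply: lerXn2r; rewrite ?nnegrE ?mulr_ge0 ?ler_piMl ?(ltW ka_gt0).
  have h2 : N ^+ 2 <= (ep * (Q - 1) * z) ^+ 2.
    by rewrite lerXn2r ?nnegrE // !mulr_ge0 //; lra.
  (* Valid since Q <= 2 ka <= 2; the product of the two bounds on N^2 carries exactly the factor 8
     (Q - 1)^2 over (ep u / 2)^2 z^5. *)
  have h3 : 8 * (Q - 1) ^+ 2 <= Q ^+ 3.
    rewrite -subr_ge0 (_ : _ - _ = (2 - Q) * (1 + (Q - 1) * (5 - Q))); last by ring.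
    by rewrite mulr_ge0 //; nra.
  rewrite -(ler_pM2r Q3) (_ : N ^+ 4 * _ = (N ^+ 2 * Q ^+ 3) * N ^+ 2); last by ring.
  apply: (@le_trans _ _ (2 * u ^+ 2 * z ^+ 3 * (ep * (Q - 1) * z) ^+ 2)).
    by apply: ler_pM => //; [rewrite mulr_ge0 ?sqr_ge0 ?ltW|exact: sqr_ge0].
  rewrite (_ : E0 ^+ 4 = (ep * u / 2) ^+ 2); last by rewrite -E0_sqr; ring.
  rewrite (_ : _ * (ep * (Q - 1) * z) ^+ 2 =
    (ep * u / 2) ^+ 2 * z ^+ 5 * (8 * (Q - 1) ^+ 2)); last by field.
  rewrite ler_wpM2l // mulr_ge0 ?sqr_ge0 // exprn_ge0 //; lra.
have t0 : 0 <= z - 1 by lra.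
have z5 : z ^+ 5 <= (1 + c * (z - 1)) ^+ 4.
  set t := z - 1 in t0 *; have -> : z = 1 + t by rewrite /t; ring.
  have t1 : t <= 1 by rewrite /t; lra.
  have -> : (1 + c * t) ^+ 4 = 1 + 4 * c * t + 6 * c ^+ 2 * t ^+ 2
      + 4 * c ^+ 2 * c * t ^+ 3 + c ^+ 2 * c ^+ 2 * t ^+ 4 by ring.
  rewrite c2.
  have ct : 14 / 10 * t <= c * t by rewrite ler_wpM2r.
  have t2 : 0 <= t ^+ 2 by exact: sqr_ge0.
  have t3 : 0 <= t ^+ 3 by exact: exprn_ge0.
  have ct3 : 14 / 10 * t ^+ 3 <= c * t ^+ 3 by rewrite ler_wpM2r.
  have t4 : t ^+ 4 <= t ^+ 3 by rewrite ler_wiXn2l.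
  have t5 : t ^+ 5 <= t ^+ 2 by rewrite ler_wiXn2l.
  have -> : (1 + t) ^+ 5 = 1 + 5 * t + 10 * t ^+ 2 + 10 * t ^+ 3 + 5 * t ^+ 4 + t ^+ 5 by ring.
  have -> : 4 * 2 * c * t ^+ 3 = 8 * (c * t ^+ 3) by ring.
  have -> : 4 * c * t = 4 * (c * t) by ring.
  lra.
have NE : N <= E0 * (1 + c * (z - 1)).
  have r0 : 0 <= E0 * (1 + c * (z - 1)) by rewrite mulr_ge0 // addr_ge0 // mulr_ge0.
  rewrite -(@ler_pXn2r _ 4) ?nnegrE // (le_trans N4) // exprMn ler_wpM2l //.
  exact: exprn_ge0.
(* So N <= E0 + (z - 1), and the excess z - 1 is absorbed as in the cubic regime. *)
have E0c : E0 * c <= 1.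
  rewrite -(@ler_pXn2r _ 2) ?nnegrE ?mulr_ge0 // exprMn E0_sqr c2 expr1n; nra.
nra.
Qed.

Lemma rate_mixed_sqr ep u ka : 0 < ep -> ep <= 1 -> 0 <= u ->
  0 < ka -> ka <= 1 ->
  (1 - ep * ka * (2 - ep - Num.sqrt (ep * u / 2))) ^+ 2 <=
    1 - ep * ka * (2 - ep - u / 2).
Proof.
move=> ep_gt0 ep_le1 u_ge0 ka_gt0 ka_le1.
set E0 := Num.sqrt _; have E0_sqr : E0 ^+ 2 = ep * (u / 2).
  by rewrite /E0 -mulrA sqr_sqrtr // !mulr_ge0 // ltW.
move: (u / 2) E0_sqr (divr_ge0 u_ge0 (ler0n R 2)) => v E0_sqr v0.
(* The arithmetic-geometric mean inequality, E0 being the geometric mean of ep and v. *)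
have E0_le : 2 * E0 <= ep + v.
  have : 0 <= (ep - v) ^+ 2 by exact: sqr_ge0.
  have e0 : 0 <= ep + v by lra.
  move=> h; have : (2 * E0) ^+ 2 <= (ep + v) ^+ 2 by rewrite exprMn E0_sqr; lra.
  by rewrite ler_pXn2r ?nnegrE // mulr_ge0 // sqrtr_ge0.
have a0 : 0 < ep * ka by rewrite mulr_gt0.
have key : ep * (2 - ep - E0) ^+ 2 + (2 - ep - v) <= 2 * (2 - ep - E0).
  rewrite -subr_ge0 (_ : _ - _ =
    (1 - ep) * ((1 - ep) * (2 - ep - 2 * E0) + v * (1 + ep))
    - ep * (E0 ^+ 2 - ep * v)); last by ring.
  rewrite E0_sqr subrr mulr0 subr0 mulr_ge0 //; first by lra.
  have h : (1 - ep) * (2 - 2 * ep - v) <= (1 - ep) * (2 - ep - 2 * E0).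
    by rewrite ler_wpM2l //; lra.
  have h2 : 0 <= (1 - ep) ^+ 2 by exact: sqr_ge0.
  have h3 : 0 <= ep * v by rewrite mulr_ge0 // ltW.
  lra.
have kab : ep * ka * (2 - ep - E0) ^+ 2 <= ep * (2 - ep - E0) ^+ 2.
  by rewrite ler_wpM2r ?sqr_ge0 // ler_piMr // ltW.
have := ler_wpM2l (ltW a0) (le_trans (lerD kab (lexx (2 - ep - v))) key).
lra.
Qed.

(** For 2 ka <= Q the cubic bound gives the factor 1 - zeta, which is below its square root.
    Otherwise the geometric mean of both bounds gives a factor whose square is at most 1 - zeta. *)
Lemma descent_rate ep u ka Q z N : 0 < ep -> ep <= 1 -> 0 <= u -> u <= 1 ->
  0 < ka -> ka <= 1 -> 1 <= Q -> 1 <= z -> ka * z <= Q -> 0 <= N ->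
  N ^+ 2 * Q ^+ 3 <= 2 * u ^+ 2 * (ka * z) ^+ 3 ->
  N <= ep * (Q - 1) * z ->
  1 - ep * ka * ((2 - ep) * z - N) <=
    Num.sqrt (1 - ep * ka * (2 - ep - u / 2)).
Proof.
move=> ep0 ep1 u0 u1 ka0 ka1 Q1 z1 kaz N0 Nc Nq.
have a0 : 0 <= ep * ka by rewrite mulr_ge0 // ltW.
case: (lerP (2 * ka) Q) => kaQ.
  have /(ler_wpM2l a0) h := rate_cubic ep1 u0 u1 ka0 Q1 z1 kaz N0 Nc kaQ.
  have /andP[ze0 ze1] := zeta_bounds ep0 ep1 u0 u1 ka0 ka1.
  apply: (@le_trans _ _ (1 - ep * ka * (2 - ep - u / 2))); first by lra.
  by apply: ler_sqr_sqrt; rewrite expr2 ler_piMl //; lra.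
have /(ler_wpM2l a0) h := rate_mixed ep0 ep1 u0 u1 ka0 ka1 Q1 z1 kaz N0 Nc Nq (ltW kaQ).
apply: le_trans (ler_sqr_sqrt (rate_mixed_sqr ep0 ep1 u0 ka0 ka1)).
by rewrite lerB.
Qed.

Lemma gap_step ep u ka Q G0 G G' q r : 0 < ep -> ep <= 1 -> 0 <= u -> u <= 1 ->
  0 < ka -> ka <= 1 -> 1 <= Q -> 0 <= G -> G <= G0 ->
  2 * ka * G <= q -> q <= 2 * Q * G -> 0 <= r ->
  r <= ep ^+ 2 * (Q - 1) / 2 * q ->
  r ^+ 2 * G0 * (4 * Q ^+ 3) <= u ^+ 2 * ep ^+ 2 * ka ^+ 2 * q ^+ 3 ->
  G' <= G - (ep - ep ^+ 2 / 2) * q + r ->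
  let zeta := ep * ka * (2 - ep - u / 2) in
  G' <= Num.sqrt (1 - zeta) * G /\
  (2 * ep * (Q - 1) <= u -> G' <= (1 - zeta) * G).
Proof.
move=> ep0 ep1 u0 u1 ka0 ka1 Q1 G_ge0 GG0 qlo qhi r0 rq rc G'le zeta.
(* The variables z and N divide by G, so a vanishing gap is treated apart; then q and r vanish
   too. *)
have := G_ge0; rewrite le_eqVlt => /predU1P[GE|G_gt0].
  have q0 : q = 0 by rewrite -GE !mulr0 in qlo qhi; apply: le_anti; rewrite qlo qhi.
  move: G'le rq; rewrite q0 -GE !mulr0 => h1 h2.
  by split=> [|_]; lra.
have kaG : 0 < 2 * ka * G by rewrite !mulr_gt0.
have eG : 0 < ep * ka * G by rewrite !mulr_gt0.
pose z := q / (2 * ka * G); pose N := r / (ep * ka * G).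
have zE : q = 2 * ka * G * z by rewrite /z; field; rewrite !gt_eqF.
have NE : r = ep * ka * G * N by rewrite /N; field; rewrite !gt_eqF.
have z1 : 1 <= z by rewrite ler_pdivlMr // mul1r.
have kaz : ka * z <= Q.
  have : ka * z * (2 * G) <= Q * (2 * G) by rewrite zE in qhi; lra.
  by rewrite ler_pM2r // mulr_gt0.
have N0 : 0 <= N by rewrite divr_ge0 // ltW.
have Nq : N <= ep * (Q - 1) * z.
  by rewrite -(ler_pM2l eG) -NE (le_trans rq) // zE; apply: eq_ler; field.
have Q3 : 0 < Q ^+ 3 by rewrite exprn_gt0 //; lra.
have Nc : N ^+ 2 * Q ^+ 3 <= 2 * u ^+ 2 * (ka * z) ^+ 3.
  have c0 : 0 < 4 * (ep * ka * G) ^+ 2 * G by rewrite !mulr_gt0 ?exprn_gt0.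
  rewrite -(ler_pM2r c0).
  have rc' : r ^+ 2 * G * (4 * Q ^+ 3) <= r ^+ 2 * G0 * (4 * Q ^+ 3).
    apply: ler_wpM2r; first by rewrite mulr_ge0 // ltW.
    by apply: ler_wpM2l => //; exact: sqr_ge0.
  have := le_trans rc' rc; rewrite {1}NE zE => h; apply: le_trans (le_trans h _).
    by apply: eq_ler; ring.
  by apply: eq_ler; ring.
have G'E : G' <= (1 - ep * ka * ((2 - ep) * z - N)) * G.
  by apply: le_trans G'le _; rewrite zE NE; apply: eq_ler; field.
split=> [|h]; apply: le_trans G'E _; rewrite ler_wpM2r //.
  exact: descent_rate Nc Nq.
have a0 : 0 <= ep * ka by rewrite mulr_ge0 // ltW.
by have := ler_wpM2l a0 (rate_quad ep1 u1 z1 Nq h); rewrite /zeta; lra.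
Qed.

End Rates.

(** * The cost of changing the preconditioner *)

Section Correction.
Context {R : realType}.

(** Dictionary: l = sqrt lambda, mu = alpha m, aL = alpha L, b and w are the square roots of the
    initial and current gaps, r = (1 - zeta)^(t/4) and s = Gamma_1 r. The conclusion says 1 + c <=
    (1 + s)^2. *)
Lemma correction_bound (l Lam d b mu ep aL u r w s c : R) :
  0 < l -> 0 < Lam -> 0 < d -> 0 <= b -> 0 < mu -> 0 < ep -> ep <= 1 ->
  0 < aL -> 0 <= u -> u <= 1 -> mu * l ^+ 2 <= 1 -> l ^+ 2 * d <= 1 ->
  1 <= Lam * d -> 0 <= r -> r <= 1 -> 0 <= w -> 0 <= s ->
  aL * ep ^+ 2 * Lam ^+ 3 * b = 3 * mu * l ^+ 5 * u ->
  w <= r * b ->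
  (2 * ep * (Lam / l ^+ 2 - 1) <= u -> w <= r ^+ 2 * b) ->
  s ^+ 2 = aL * ep * Lam * b * r ^+ 2 / (l ^+ 3 * d ^+ 2) ->
  (1 - ep) * (1 + s) < 1 ->
  c <= aL * ep * Lam * (Num.sqrt 2 * w / l) / d ->
  c <= 2 * s + s ^+ 2.
Proof.
move=> l0 Lam0 d0 b0 mu0 ep0 ep1 aL0 u0 u1 mul ld Lamd r0 r1 w0 s0.
move=> uE w_half w_full sE eta1 cle; apply: le_trans cle _.
set q2 := Num.sqrt (2 : R); have q2_ge0 : 0 <= q2 by exact: sqrtr_ge0.
have q2_sqr : q2 ^+ 2 = 2 by rewrite sqr_sqrtr.
pose B := aL * ep * Lam / (l * d); pose A := B * b.
have B0 : 0 < B by rewrite divr_gt0 ?mulr_gt0.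
have A0 : 0 <= A by rewrite mulr_ge0 // ltW.
have -> : aL * ep * Lam * (q2 * w / l) / d = q2 * B * w.
  by rewrite /B; field; rewrite !gt_eqF.
have ld0 : 0 < l ^+ 2 * d by rewrite mulr_gt0 ?exprn_gt0.
have sA : s ^+ 2 * (l ^+ 2 * d) = A * r ^+ 2.
  by rewrite sE /A /B; field; rewrite !gt_eqF.
have AE : A * (l ^+ 2 * d) * (ep * Lam ^+ 2) = 3 * mu * l ^+ 6 * u.
  rewrite (_ : 3 * _ * _ * _ = 3 * mu * l ^+ 5 * u * l); last by ring.
  by rewrite -uE /A /B; field; rewrite !gt_eqF.
have q2B : 0 <= q2 * B by rewrite mulr_ge0 // ltW.
(* A (l^2 d) = 3 u ka / (ep Q^2) separates the two regimes. *)
case: (lerP (A * (l ^+ 2 * d)) 2) => Ald.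
  (* With the weak rate, sqrt 2 A r <= 2 s is needed; squared and multiplied by l^2 d, it follows
     from A l^2 d <= 2. *)
  apply: (@le_trans _ _ (2 * s)); last by rewrite lerDl sqr_ge0.
  apply: le_trans (ler_wpM2l q2B w_half) _.
  have -> : q2 * B * (r * b) = q2 * A * r by rewrite /A; ring.
  have qAr : 0 <= q2 * A * r := mulr_ge0 (mulr_ge0 q2_ge0 A0) r0.
  have s20 : 0 <= 2 * s by rewrite mulr_ge0.
  rewrite -(@ler_pXn2r _ 2) ?nnegrE // -(ler_pM2r ld0).
  have -> : (q2 * A * r) ^+ 2 = q2 ^+ 2 * A ^+ 2 * r ^+ 2 by ring.
  rewrite q2_sqr [(2 * s) ^+ 2]exprMn.
  have -> : 2 ^+ 2 * s ^+ 2 * (l ^+ 2 * d) = 2 * A * r ^+ 2 * 2.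
    by rewrite -[_ * s ^+ 2 * _]mulrA sA; ring.
  have -> : 2 * A ^+ 2 * r ^+ 2 * (l ^+ 2 * d) =
      2 * A * r ^+ 2 * (A * (l ^+ 2 * d)) by ring.
  by apply: ler_wpM2l => //; rewrite mulr_ge0 ?sqr_ge0 // mulr_ge0.
pose Q := Lam / l ^+ 2; have LamE : Lam = Q * l ^+ 2.
  by rewrite /Q divfK // gt_eqF // exprn_gt0.
have u_big : 2 * ep * Q ^+ 2 <= 3 * u.
  have e1 : 0 < ep * Lam ^+ 2 by rewrite mulr_gt0 // exprn_gt0.
  have l4 : 0 < l ^+ 4 by rewrite exprn_gt0.
  rewrite -(ler_pM2r l4).
  have h := ltW Ald; rewrite -(ler_pM2r e1) AE in h.
  have -> : 2 * ep * Q ^+ 2 * l ^+ 4 = 2 * (ep * Lam ^+ 2) by rewrite LamE; ring.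
  apply: le_trans h _.
  have -> : 3 * mu * l ^+ 6 * u = 3 * u * l ^+ 4 * (mu * l ^+ 2) by ring.
  by rewrite ler_piMr // !mulr_ge0 // ltW.
have /w_full w_le : 2 * ep * (Lam / l ^+ 2 - 1) <= u.
  (* As 3 (Q - 1) <= Q^2, the bound 2 ep Q^2 <= 3 u yields 2 ep (Q - 1) <= u, the condition for the
     strong rate. *)
  rewrite -/Q; have : 0 <= ep * (Q ^+ 2 - 3 * Q + 3).
    by rewrite mulr_ge0 ?ltW //; have := sqr_ge0 (Q - 3 / 2); lra.
  lra.
apply: le_trans (ler_wpM2l q2B w_le) _.
have -> : q2 * B * (r ^+ 2 * b) = q2 * (s ^+ 2 * (l ^+ 2 * d)).
  by rewrite sA /A; ring.
have s2 : 0 <= s ^+ 2 by exact: sqr_ge0.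
apply: (@le_trans _ _ (q2 * s ^+ 2)); first by rewrite ler_wpM2l // ler_piMr.
(* Then s <= 4 suffices, since (3 / 2) s^2 <= 2 s + s^2 for such s. *)
have q2_le : q2 <= 3 / 2.
  by rewrite -(@ler_pXn2r _ 2) ?nnegrE // q2_sqr; lra.
(* This is the only use of eta < 1. *)
suff s4 : s <= 4.
  have : s * s <= s * 4 by rewrite ler_wpM2l.
  have : q2 * s ^+ 2 <= 3 / 2 * s ^+ 2 by rewrite ler_wpM2r.
  lra.
(* The constants give s^2 <= 3 / ep, which is at most 16 from ep = 3 / 16 on. For smaller ep, s > 4
   would make (1 - ep)(1 + s) exceed 1. *)
case: (lerP (3 / 16) ep) => ep16; last first.
  rewrite leNgt; apply/negP => s4; move: eta1; rewrite ltNge => /negP; apply.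
  have : (1 - ep) * 5 <= (1 - ep) * (1 + s) by rewrite ler_wpM2l //; lra.
  lra.
rewrite -(@ler_pXn2r _ 2) ?nnegrE //.
have ld2 : 0 < (l ^+ 2 * d) ^+ 2 * (ep * Lam ^+ 2) by rewrite !mulr_gt0 ?exprn_gt0.
rewrite -(ler_pM2r ld2).
have -> : s ^+ 2 * ((l ^+ 2 * d) ^+ 2 * (ep * Lam ^+ 2)) = 3 * mu * l ^+ 6 * u * r ^+ 2.
  rewrite -AE.
  rewrite (_ : s ^+ 2 * _ =
    s ^+ 2 * (l ^+ 2 * d) * (l ^+ 2 * d * (ep * Lam ^+ 2))); last by ring.
  by rewrite sA; ring.
have -> : 4 ^+ 2 * ((l ^+ 2 * d) ^+ 2 * (ep * Lam ^+ 2)) =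
    l ^+ 4 * (16 * ep * (Lam * d) ^+ 2) by ring.
have -> : 3 * mu * l ^+ 6 * u * r ^+ 2 =
    l ^+ 4 * (3 * ((mu * l ^+ 2) * (u * r ^+ 2))) by ring.
apply: ler_wpM2l; first by rewrite exprn_ge0 // ltW.
have h1 : (mu * l ^+ 2) * (u * r ^+ 2) <= 1.
  have ur : u * r ^+ 2 <= 1 by rewrite mulr_ile1 ?exprn_ge0 // expr_le1.
  by rewrite mulr_ile1 // mulr_ge0 ?exprn_ge0 // ltW.
have h2 : 1 <= (Lam * d) ^+ 2 by rewrite exprn_ege1.
have : 16 * ep * 1 <= 16 * ep * (Lam * d) ^+ 2 by rewrite ler_wpM2l //; lra.
lra.
Qed.

End Correction.

(** * The constants of the method *)

Section ConstantsTheory.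
Context {R : realType}.
Variables (alpha m M L delta Delta gap : R) (K : nat).
Hypotheses (alpha_gt0 : 0 < alpha) (m_gt0 : 0 < m) (m_M : m <= M).
Hypotheses (delta_Delta : delta <= Delta) (Delta_lt1 : Delta < 1).
Hypotheses (L_gt0 : 0 < L) (gap_ge0 : 0 <= gap).

Local Notation rho := (rho_cst alpha m delta).
Local Notation lambda := (lambda_cst alpha M delta).
Local Notation Lambda := (Lambda_cst alpha m delta Delta K).
Local Notation eps := (stepsize alpha m M L delta Delta K gap).
Local Notation zeta := (zeta_cst alpha m M L delta Delta K gap).
Local Notation d := (2 * (1 - Delta) + alpha * m).
Local Notation nu := (2 * (1 - delta) + alpha * M).
Local Notation l := (Num.sqrt lambda).
Local Notation b := (Num.sqrt gap).

Lemma am_gt0 : 0 < alpha * m. Proof. exact: mulr_gt0. Qed.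

Lemma d_gt0 : 0 < d.
Proof. have := am_gt0; have := Delta_lt1; lra. Qed.

Lemma d_le_nu : d <= nu.
Proof.
have := ler_wpM2l (ltW alpha_gt0) m_M; have := delta_Delta; lra.
Qed.

Lemma nu_gt0 : 0 < nu.
Proof. exact: lt_le_trans d_gt0 d_le_nu. Qed.

Lemma rho_bounds : 0 <= rho < 1.
Proof.
have am := am_gt0; have h := delta_Delta; have h' := Delta_lt1.
have c0 : 0 < 2 * (1 - delta) + alpha * m by lra.
rewrite /rho_cst ltr_pdivrMr // divr_ge0 ?(ltW c0) //=; lra.
Qed.

Lemma LambdaE : Lambda = (\sum_(k < K.+1) rho ^+ k) / d.
Proof.
have /andP[_ r1] := rho_bounds.
have r1' : 1 - rho != 0 by rewrite subr_eq0 eq_sym lt_eqF.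
rewrite /Lambda_cst invfM mulrA; congr (_ / _).
rewrite -opprB subrX1 -mulNr opprB.
by rewrite [X in X / _]mulrC mulfK.
Qed.

Lemma geom_ge1 : 1 <= \sum_(k < K.+1) rho ^+ k.
Proof.
have /andP[r0 _] := rho_bounds.
by rewrite big_ord_recl expr0 lerDl sumr_ge0 // => k _; rewrite exprn_ge0.
Qed.

Lemma Lambda_d : 1 <= Lambda * d.
Proof. by rewrite LambdaE divfK ?gt_eqF ?d_gt0 // geom_ge1. Qed.

Lemma Lambda_gt0 : 0 < Lambda.
Proof.
by rewrite LambdaE divr_gt0 ?d_gt0 // (lt_le_trans ltr01) // geom_ge1.
Qed.

Lemma lambda_gt0 : 0 < lambda.
Proof. by rewrite invr_gt0 nu_gt0. Qed.

Lemma l_gt0 : 0 < l.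
Proof. by rewrite sqrtr_gt0 lambda_gt0. Qed.

Lemma l_sqr : l ^+ 2 = lambda.
Proof. by rewrite sqr_sqrtr // ltW // lambda_gt0. Qed.

Lemma lambda_d : l ^+ 2 * d <= 1.
Proof. by rewrite l_sqr mulrC ler_pdivrMr ?nu_gt0 // mul1r d_le_nu. Qed.

Lemma lambda_am : alpha * m * l ^+ 2 <= 1.
Proof.
rewrite l_sqr ler_pdivrMr ?nu_gt0 // mul1r.
have := d_le_nu; have := Delta_lt1; lra.
Qed.

Lemma powR_half (x : R) (k : nat) : 0 <= x -> x `^ (k%:R / 2) = Num.sqrt x ^+ k.
Proof.
by move=> x0; rewrite mulrC powRrM powR12_sqrt // powR_mulrn.
Qed.

Lemma powR_quarter (x : R) (k : nat) : 0 <= x ->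
  (x `^ (k%:R / 4)) ^+ 2 = Num.sqrt x ^+ k.
Proof.
move=> x0; rewrite -powR_half // -powR_mulrn ?powR_ge0 // -powRrM.
by congr (_ `^ _); field.
Qed.

(** The cap on eps^2 is stated without division, so that it also covers a vanishing denominator. *)
Lemma stepsize_bounds :
  [/\ 0 < eps, eps <= 1 & L * Lambda ^+ 3 * b * eps ^+ 2 <= 3 * m * l ^+ 5].
Proof.
have l5 : lambda `^ (5 / 2) = l ^+ 5 by rewrite powR_half // ltW // lambda_gt0.
have rhs0 : 0 < 3 * m * l ^+ 5 by rewrite !mulr_gt0 ?exprn_gt0 ?l_gt0.
rewrite /stepsize /= l5; case: eqVneq => [->|den0].
  by split; rewrite ?ltr01 ?lexx // mul0r ltW.
set den := L * _ * _ in den0 *.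
have den_gt0 : 0 < den.
  have Lg := Lambda_gt0; rewrite lt_neqAle eq_sym den0 /= mulr_ge0 ?sqrtr_ge0 //.
  by rewrite mulr_ge0 ?exprn_ge0 ?ltW.
set x := Num.sqrt (_ / den); have x0 : 0 < x by rewrite sqrtr_gt0 divr_gt0.
have x2 : den * x ^+ 2 = 3 * m * l ^+ 5.
  by rewrite sqr_sqrtr ?divr_ge0 ?ltW // mulrC divfK.
split; first by rewrite lt_min ltr01.
  by rewrite ge_min lexx.
rewrite -x2 ler_pM2l // lerXn2r ?nnegrE ?(ltW x0) ?ge_min ?lexx ?orbT //.
by rewrite le_min ler01 ltW.
Qed.

(** The variable [u] of the scalar inequalities; it is 0 when the initial gap vanishes. *)
Definition step_ratio : R := L * Lambda ^+ 3 * b * eps ^+ 2 / (3 * m * l ^+ 5).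

Lemma step_ratioE :
  alpha * L * eps ^+ 2 * Lambda ^+ 3 * b = 3 * (alpha * m) * l ^+ 5 * step_ratio.
Proof.
by rewrite /step_ratio; field; rewrite !gt_eqF ?l_gt0.
Qed.

Lemma step_ratio_bounds : 0 <= step_ratio <= 1.
Proof.
have [e0 _ h] := stepsize_bounds.
have c0 : 0 < 3 * m * l ^+ 5 by rewrite !mulr_gt0 ?exprn_gt0 ?l_gt0.
rewrite ler_pdivrMr // mul1r h andbT divr_ge0 ?(ltW c0) //.
have Lg := Lambda_gt0; apply: mulr_ge0; last exact: sqr_ge0.
by rewrite mulr_ge0 ?sqrtr_ge0 // mulr_ge0 ?exprn_ge0 ?ltW.
Qed.

Lemma zetaE :
  zeta = eps * (alpha * m * l ^+ 2) * (2 - eps - step_ratio / 2).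
Proof.
have l3 : lambda `^ (3 / 2) = l ^+ 3 by rewrite powR_half // ltW // lambda_gt0.
rewrite /zeta_cst l3 -[X in _ * X - _]l_sqr.
have -> : alpha * eps ^+ 3 * L * Lambda ^+ 3 * b =
    eps * (alpha * L * eps ^+ 2 * Lambda ^+ 3 * b) by ring.
rewrite step_ratioE; field; rewrite gt_eqF ?l_gt0 //.
Qed.

Lemma zeta01 : 0 <= zeta <= 1.
Proof.
have [e0 e1 _] := stepsize_bounds; have /andP[u0 u1] := step_ratio_bounds.
rewrite zetaE; apply: zeta_bounds => //; last exact: lambda_am.
by rewrite mulr_gt0 ?am_gt0 // exprn_gt0 // l_gt0.
Qed.

Lemma Gamma2E : Gamma2_cst alpha m M L delta Delta K =
  alpha * L / 2 * Lambda ^+ 2 * nu / Num.sqrt d.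
Proof.
rewrite /Gamma2_cst /lambda_cst; field.
by rewrite !gt_eqF ?sqrtr_gt0 ?d_gt0 ?nu_gt0.
Qed.

Lemma Gamma2_gt0 : 0 < Gamma2_cst alpha m M L delta Delta K.
Proof.
have aL : 0 < alpha * L / 2 by rewrite divr_gt0 ?mulr_gt0.
rewrite Gamma2E divr_gt0 ?sqrtr_gt0 ?d_gt0 //.
by rewrite mulr_gt0 ?nu_gt0 // mulr_gt0 // exprn_gt0 // Lambda_gt0.
Qed.

Lemma Gamma1_ge0 : 0 <= Gamma1_cst alpha m M L delta Delta K gap.
Proof.
rewrite /Gamma1_cst divr_ge0 ?mulr_ge0 ?sqrtr_ge0 ?powR_ge0 //.
exact: ltW d_gt0.
Qed.

Lemma Gamma1_sqr : Gamma1_cst alpha m M L delta Delta K gap ^+ 2 =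
  alpha * L * eps * Lambda * b / (l ^+ 3 * d ^+ 2).
Proof.
have [e0 _ _] := stepsize_bounds.
rewrite /Gamma1_cst expr_div_n !exprMn sqr_sqrtr.
  rewrite (powR_quarter 1) // (powR_quarter 3) ?(ltW lambda_gt0) // expr1.
  by congr (_ / _); ring.
exact: ltW (mulr_gt0 (mulr_gt0 (mulr_gt0 alpha_gt0 e0) L_gt0) Lambda_gt0).
Qed.

End ConstantsTheory.

(** * The iteration *)

Lemma addr_cancel (V : zmodType) (a x h : V) : a + (x - a - - h) - h = x.
Proof. by rewrite opprK addrA addrK addrC subrK. Qed.

Lemma damped_combination (R : pzRingType) (V : lmodType R) (a : R) (w t q : V) :
  w + t - a *: (w - q) = (1 - a) *: w + (a *: q + t).
Proof.
rewrite scalerBr scalerBl scale1r opprB (addrC (a *: q) t) [RHS]addrACA.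
by rewrite [in RHS](addrC (- _)).
Qed.

(** Bound |v|^6 by (Lambda q)^3 and eliminate aL through the stepsize relation. The result is the
    cubic hypothesis of [gap_step], with b^2 as the initial gap. *)
Lemma cubic_remainder_bound (R : realType) (aL ep Lam l b mu u q nv : R) :
  0 < l -> 0 < Lam -> 0 <= q -> 0 <= nv -> nv ^+ 2 <= Lam * q ->
  aL * ep ^+ 2 * Lam ^+ 3 * b = 3 * mu * l ^+ 5 * u ->
  (aL * ep ^+ 3 * nv ^+ 3 / 6) ^+ 2 * b ^+ 2 * (4 * (Lam / l ^+ 2) ^+ 3)
    <= u ^+ 2 * ep ^+ 2 * (mu * l ^+ 2) ^+ 2 * q ^+ 3.
Proof.
move=> l0 Lam0 q0 nv0 nvq uE.
have nv6 : (nv ^+ 2) ^+ 3 <= (Lam * q) ^+ 3.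
  by rewrite lerXn2r ?nnegrE ?sqr_ge0 // mulr_ge0 // ltW.
pose k := (aL * ep ^+ 3) ^+ 2 * b ^+ 2 * (Lam / l ^+ 2) ^+ 3 / 9.
have k0 : 0 <= k.
  have Q0 : 0 <= Lam / l ^+ 2 by rewrite divr_ge0 ?(ltW Lam0) // exprn_ge0 ?ltW.
  apply: divr_ge0 => //; apply: mulr_ge0; last exact: exprn_ge0.
  by apply: mulr_ge0 => //; exact: sqr_ge0.
have -> : (aL * ep ^+ 3 * nv ^+ 3 / 6) ^+ 2 * b ^+ 2 * (4 * (Lam / l ^+ 2) ^+ 3)
    = k * (nv ^+ 2) ^+ 3.
  by rewrite /k; field; rewrite gt_eqF.
apply: le_trans (ler_wpM2l k0 nv6) _; apply: eq_ler; have -> : k * (Lam * q) ^+ 3 =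
    (aL * ep ^+ 2 * Lam ^+ 3 * b) ^+ 2 * ep ^+ 2 * q ^+ 3 / (9 * l ^+ 6).
  by rewrite /k; field; rewrite gt_eqF.
by rewrite uE; field; rewrite gt_eqF.
Qed.

Section NetworkNewton.
Context {R : realType} (n p K : nat).
Variables (W : 'M[R]_n) (f : 'I_n -> 'cV[R]_p -> R).
Variables (alpha delta Delta m M L : R).
Hypotheses (W_sym : W^T = W) (W_ge0 : forall i j, 0 <= W i j).
Hypothesis W_stoch : W *m (const_mx 1 : 'cV[R]_n) = const_mx 1.
Hypothesis f_diff2 : forall i, twice_differentiable (f i).
Hypotheses (alpha_gt0 : 0 < alpha) (m_gt0 : 0 < m) (m_M : m <= M).
Hypotheses (delta_Delta : delta <= Delta) (Delta_lt1 : Delta < 1).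
Hypothesis W_diag : forall i, delta <= W i i <= Delta.
Hypothesis hess_bounds : forall i (z : 'cV[R]_p),
  loewner_le m%:M (hessian (f i) z) /\ loewner_le (hessian (f i) z) M%:M.
Hypothesis L_gt0 : 0 < L.
Hypothesis hess_lipschitz : forall i (z z' : 'cV[R]_p),
  spectral_norm (hessian (f i) z - hessian (f i) z') <= L * l2norm (z - z').
Variable ystar : 'cV[R]_(n * p).
Hypothesis ystar_argmin :
  forall z, objective alpha W f ystar <= objective alpha W f z.

Local Notation F := (objective alpha W f).
Local Notation g := (obj_grad W f alpha).
Local Notation D := (Dmx alpha W f).
Local Notation B := (Bmx p W).
Local Notation H y := (D y - B).
Local Notation T y := (invsqrtmx (D y)).
Local Notation rho := (rho_cst alpha m delta).
Local Notation lambda := (lambda_cst alpha M delta).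
Local Notation Lambda := (Lambda_cst alpha m delta Delta K).
Local Notation d := (2 * (1 - Delta) + alpha * m).
Local Notation nu := (2 * (1 - delta) + alpha * M).
Local Notation l := (Num.sqrt lambda).

Implicit Types x y v : 'cV[R]_(n * p).

Definition newton_dir y := newton_inv (D y) B K *m g y.
Definition newton_dec y := dotv (g y) (newton_dir y).

Let dgt0 : 0 < d := d_gt0 alpha_gt0 m_gt0 Delta_lt1.
Let nugt0 : 0 < nu := nu_gt0 alpha_gt0 m_gt0 m_M delta_Delta Delta_lt1.
Let Dsym y := Dmx_sym W alpha hess_bounds y.
Let Dge y := Dmx_ge alpha_gt0 W_diag hess_bounds y.
Let Dle y := Dmx_le alpha_gt0 W_diag hess_bounds y.
Let Bsym := Bmx_sym p W_sym.
Let Bge0 := Bmx_ge0 (p := p) W_sym W_ge0 W_stoch.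
Let Ble y := Bmx_le_Dmx W_sym W_ge0 W_stoch alpha_gt0 m_gt0 Delta_lt1 W_diag
  hess_bounds delta_Delta y.

Let rho_ge0 : 0 <= rho.
Proof. by have /andP[] := rho_bounds alpha_gt0 m_gt0 delta_Delta Delta_lt1. Qed.

Let LamE := LambdaE K alpha_gt0 m_gt0 delta_Delta Delta_lt1.

Lemma newton_dec_lower y : dotv (g y) (g y) <= nu * newton_dec y.
Proof.
exact: newton_inv_lower (Dsym y) Bsym dgt0 rho_ge0 (ltW nugt0) (Dge y) (Dle y)
  Bge0 (Ble y) (g y).
Qed.

Lemma newton_dec_upper y : newton_dec y <= Lambda * dotv (g y) (g y).
Proof.
rewrite LamE.
exact: newton_inv_upper (Dsym y) Bsym dgt0 rho_ge0 (Dge y) Bge0 (Ble y) (g y).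
Qed.

Lemma newton_dir_sqr y : l2norm (newton_dir y) ^+ 2 <= Lambda * newton_dec y.
Proof.
rewrite sqr_l2norm LamE.
exact: newton_inv_sqr_le (Dsym y) Bsym dgt0 rho_ge0 (Dge y) Bge0 (Ble y) (g y).
Qed.

Lemma newton_dir_norm y : l2norm (newton_dir y) <= Lambda * l2norm (g y).
Proof.
rewrite LamE.
exact: newton_inv_norm (Dsym y) Bsym dgt0 rho_ge0 (Dge y) Bge0 (Ble y) (g y).
Qed.

Lemma newton_dir_curvature y :
  dotv (newton_dir y) (H y *m newton_dir y) <= newton_dec y.
Proof.
exact: newton_inv_curvature (Dsym y) Bsym dgt0 rho_ge0 (Dge y) Bge0 (Ble y) (g y).
Qed.

Lemma newton_step_cubic y ep : 0 < ep ->
  F (y - ep *: newton_dir y) <= F y - (ep - ep ^+ 2 / 2) * newton_dec y +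
    alpha * L * ep ^+ 3 * l2norm (newton_dir y) ^+ 3 / 6.
Proof.
move=> ep0; have cur := newton_dir_curvature y.
have h := objective_cubic_le W_sym f_diff2 alpha_gt0 L_gt0 hess_lipschitz y
  (- ep *: newton_dir y).
rewrite -scaleNr; apply: le_trans h _.
rewrite dotvZl [dotv (newton_dir y) (g y)]dotvC -/(newton_dec y).
rewrite -(scalemxAr (- ep) (H y)) dotvZl dotvZr l2normZ normrN (gtr0_norm ep0).
move: (F y) (newton_dec y) (dotv _ (H y *m _)) (l2norm _) cur => a q k nv cur.
have : ep ^+ 2 * k <= ep ^+ 2 * q by rewrite ler_wpM2l // sqr_ge0.
rewrite exprMn; lra.
Qed.

Lemma newton_step_quad y ep : 0 < ep ->
  F (y - ep *: newton_dir y) <= F y - (ep - ep ^+ 2 / 2) * newton_dec y +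
    ep ^+ 2 * (alpha * (M - m)) * l2norm (newton_dir y) ^+ 2 / 2.
Proof.
move=> ep0; have cur := newton_dir_curvature y.
have h := objective_quad_le W_sym f_diff2 alpha_gt0 hess_bounds y
  (- ep *: newton_dir y).
rewrite -scaleNr; apply: le_trans h _.
rewrite dotvZl [dotv (newton_dir y) (g y)]dotvC -/(newton_dec y) sqr_l2norm.
rewrite -(scalemxAr (- ep) (H y)) !dotvZl !dotvZr.
move: (F y) (newton_dec y) (dotv _ _) (dotv _ (H y *m _)) cur => a q nv k cur.
have : ep ^+ 2 * k <= ep ^+ 2 * q by rewrite ler_wpM2l // sqr_ge0.
lra.
Qed.

(** D_y - D_y' = alpha (G_y - G_y') is at most alpha L |y - y'|, hence at most alpha L |y - y'| / d
    times D_y', because D_y' >= d. *)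
Lemma invsqrt_change y y' x :
  l2norm (T y' *m x) <=
    Num.sqrt (1 + alpha * L * l2norm (y - y') / d) * l2norm (T y *m x).
Proof.
have c0 : 0 <= alpha * L * l2norm (y - y') / d.
  by rewrite divr_ge0 ?(ltW dgt0) // mulr_ge0 ?l2norm_ge0 // mulr_ge0 ?ltW.
apply: (invsqrtmx_compare (Dsym y') (Dsym y) dgt0 (Dge y') (Dge y)).
  by rewrite addr_ge0.
move=> z; rewrite mulrDl mul1r -lerBlDl.
have -> : dotv z (D y *m z) - dotv z (D y' *m z) =
    alpha * dotv z ((Gmx f y - Gmx f y') *m z).
  rewrite -(hess_obj_diff W f alpha y y' z z).
  rewrite -!dotvBr -!mulmxBl; congr (dotv z (_ *m z)).
  by rewrite opprB addrA subrK.
have h1 := Gmx_lipschitz L_gt0 hess_lipschitz y y' z z.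
rewrite -expr2 sqr_l2norm -(ler_pM2l alpha_gt0) in h1; apply: le_trans h1 _.
have := ler_wpM2l c0 (Dge y' z); apply: le_trans.
by apply: eq_ler; field; rewrite gt_eqF.
Qed.

Lemma newton_grad_step y ep : 0 < ep -> ep <= 1 ->
  l2norm (T y *m g (y - ep *: newton_dir y)) <=
    (1 - ep + ep * rho ^+ K.+1) * l2norm (T y *m g y) +
    ep ^+ 2 * (alpha * L / 2 * Lambda ^+ 2 / Num.sqrt d) * dotv (g y) (g y).
Proof.
move=> ep0 ep1; set v := newton_dir y; set w := T y *m g y.
have [r rE] : exists r, r = g (y + - ep *: v) - g y - H y *m (- ep *: v).
  by eexists.
have gE : g (y - ep *: v) = g y + r - ep *: (H y *m v).
  rewrite rE -(scalemxAr (- ep) (H y)) !scaleNr.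
  exact/esym/addr_cancel.
(* The exact identity behind the linear factor: the Hessian part of the step removes ep w and leaves
   only ep P^(K+1) w. *)
have TE : T y *m g (y - ep *: v) =
    (1 - ep) *: w +
    (ep *: ((T y *m B *m T y) ^+ K.+1 *m w) + T y *m r).
  rewrite gE mulmxBr mulmxDr -scalemxAr.
  rewrite (hessian_newton_inv B K (Dsym y) dgt0 (Dge y) (g y)) -/w.
  exact: damped_combination.
have r_le : l2norm (T y *m r) <=
    ep ^+ 2 * (alpha * L / 2 * Lambda ^+ 2 / Num.sqrt d) * dotv (g y) (g y).
  have h1 := obj_grad_remainder W f_diff2 alpha_gt0 L_gt0 hess_lipschitz y (- ep *: v).
  rewrite -rE l2normZ normrN (gtr0_norm ep0) in h1.
  have sd : 0 < Num.sqrt d by rewrite sqrtr_gt0.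
  have h2 : l2norm (T y *m r) <= l2norm r / Num.sqrt d.
    apply: ler_l2norm; first by rewrite divr_ge0 ?l2norm_ge0 // ltW.
    rewrite expr_div_n (sqr_l2norm r) sqr_sqrtr ?(ltW dgt0) // ler_pdivlMr // mulrC.
    exact: invsqrtmx_upper (Dsym y) dgt0 (Dge y) r.
  apply: le_trans h2 _; rewrite ler_pdivrMr //; apply: le_trans h1 _.
  have aL : 0 <= alpha * L / 2 by rewrite divr_ge0 // mulr_ge0 ?ltW.
  have h3 : l2norm v ^+ 2 <= (Lambda * l2norm (g y)) ^+ 2.
    apply: lerXn2r; rewrite ?nnegrE ?l2norm_ge0 //; last exact: newton_dir_norm.
    by rewrite mulr_ge0 ?l2norm_ge0 // ltW // (Lambda_gt0 K alpha_gt0 m_gt0 delta_Delta).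
  rewrite exprMn (sqr_l2norm (g y)) in h3.
  have h4 := ler_wpM2l (mulr_ge0 aL (sqr_ge0 ep)) h3.
  have -> : alpha * L / 2 * (ep * l2norm v) ^+ 2 =
      alpha * L / 2 * ep ^+ 2 * l2norm v ^+ 2 by ring.
  apply: le_trans h4 _.
  apply: eq_ler; field.
  by rewrite gt_eqF.
rewrite TE (le_trans (ler_l2normD _ _)) // mulrDl -addrA lerD //.
  by rewrite l2normZ ger0_norm ?subr_ge0.
rewrite (le_trans (ler_l2normD _ _)) // lerD //.
rewrite l2normZ (gtr0_norm ep0) -mulrA ler_wpM2l ?(ltW ep0) //.
exact: precondX_norm (Dsym y) Bsym dgt0 rho_ge0 (Dge y) Bge0 (Ble y) K.+1 w.
Qed.

(** * Gap rates along the iterates and the recursion for the scaled gradient *)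

Section Iterates.
Variable gap0 : R.
Hypothesis gap0_ge0 : 0 <= gap0.

Local Notation eps := (stepsize alpha m M L delta Delta K gap0).
Local Notation zeta := (zeta_cst alpha m M L delta Delta K gap0).
Local Notation u := (step_ratio alpha m M L delta Delta gap0 K).

Let l_pos : 0 < l := l_gt0 alpha_gt0 m_gt0 m_M delta_Delta Delta_lt1.
Let Lam_pos : 0 < Lambda := Lambda_gt0 K alpha_gt0 m_gt0 delta_Delta Delta_lt1.
Let lE : l ^+ 2 = nu^-1 := l_sqr alpha_gt0 m_gt0 m_M delta_Delta Delta_lt1.

(** With nu = 1 / l^2, Lambda (nu - alpha (M - m)) = Lambda (2 (1 - delta) + alpha m) >= Lambda d >=
    1. *)
Lemma hess_spread : alpha * (M - m) * Lambda <= Lambda / l ^+ 2 - 1.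
Proof.
rewrite lE invrK.
have h := Lambda_d K alpha_gt0 m_gt0 delta_Delta Delta_lt1.
have h2 : Lambda * d <= Lambda * (2 * (1 - delta) + alpha * m).
  by rewrite ler_wpM2l ?(ltW Lam_pos) //; have := delta_Delta; lra.
lra.
Qed.

Lemma newton_gap_step y : F y - F ystar <= gap0 ->
  F (y - eps *: newton_dir y) - F ystar <=
    Num.sqrt (1 - zeta) * (F y - F ystar) /\
  (2 * eps * (Lambda / l ^+ 2 - 1) <= u ->
   F (y - eps *: newton_dir y) - F ystar <= (1 - zeta) * (F y - F ystar)).
Proof.
move=> Gle.
have [e0 e1 _] := stepsize_bounds gap0 K alpha_gt0 m_gt0 m_M delta_Delta
  Delta_lt1 L_gt0.
have /andP[u0 u1] := step_ratio_bounds gap0 K alpha_gt0 m_gt0 m_M delta_Delta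
  Delta_lt1 L_gt0.
rewrite (zetaE L gap0 K alpha_gt0 m_gt0 m_M delta_Delta Delta_lt1).
have l0 := l_pos; have l2 : 0 < l ^+ 2 by rewrite exprn_gt0.
have ka0 : 0 < alpha * m * l ^+ 2 by rewrite !mulr_gt0.
have ka1 := lambda_am alpha_gt0 m_gt0 m_M delta_Delta Delta_lt1.
have Q1 : 1 <= Lambda / l ^+ 2.
  have := hess_spread; have : 0 <= alpha * (M - m) * Lambda.
    by rewrite mulr_ge0 ?(ltW Lam_pos) // mulr_ge0 ?(ltW alpha_gt0) // subr_ge0.
  lra.
have q0 : 0 <= newton_dec y.
  have := le_trans (dotv_ge0 (g y)) (newton_dec_lower y).
  by rewrite pmulr_rge0.
have G0 : 0 <= F y - F ystar by rewrite subr_ge0.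
set c3 := alpha * L * eps ^+ 3 * l2norm (newton_dir y) ^+ 3 / 6.
set c2 := eps ^+ 2 * (alpha * (M - m)) * l2norm (newton_dir y) ^+ 2 / 2.
have nv0 := l2norm_ge0 (newton_dir y).
have c30 : 0 <= c3.
  rewrite divr_ge0 // mulr_ge0 ?exprn_ge0 // mulr_ge0 ?exprn_ge0 ?(ltW e0) //.
  by rewrite mulr_ge0 ?ltW.
have c20 : 0 <= c2.
  rewrite divr_ge0 // mulr_ge0 ?sqr_ge0 // mulr_ge0 ?sqr_ge0 //.
  by rewrite mulr_ge0 ?(ltW alpha_gt0) // subr_ge0.
have nu_l : nu = (l ^+ 2)^-1 by rewrite lE invrK.
(* Taking the minimum of the cubic and quadratic remainders gives a single r that satisfies both
   bounds. *)
apply: (@gap_step _ eps u (alpha * m * l ^+ 2) (Lambda / l ^+ 2) gap0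
  (F y - F ystar)
  (F (y - eps *: newton_dir y) - F ystar) (newton_dec y) (Num.min c3 c2)) => //.
- have h1 := gap_le_grad W_sym W_ge0 W_stoch f_diff2 alpha_gt0 m_gt0 hess_bounds ystar y.
  have h2 := le_trans h1 (newton_dec_lower y).
  rewrite nu_l [X in _ <= X]mulrC ler_pdivlMr // in h2; apply: le_trans h2.
  by apply: eq_ler; ring.
- have h1 := grad_le_gap W_sym W_ge0 W_stoch f_diff2 alpha_gt0 W_diag hess_bounds
    ystar_argmin y nugt0.
  have h2 := ler_wpM2l (ltW Lam_pos) h1.
  apply: le_trans (newton_dec_upper y) _; apply: le_trans h2 _.
  by rewrite nu_l; apply: eq_ler; ring.
- by rewrite le_min c30.
- rewrite ge_min; apply/orP; right.
  have a0 : 0 <= alpha * (M - m) by rewrite mulr_ge0 ?(ltW alpha_gt0) // subr_ge0.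
  have h1 := ler_wpM2l a0 (newton_dir_sqr y).
  have h2 := ler_wpM2r q0 hess_spread.
  have h3 : alpha * (M - m) * l2norm (newton_dir y) ^+ 2 <=
      (Lambda / l ^+ 2 - 1) * newton_dec y by apply: le_trans h1 _; rewrite mulrA.
  have := ler_wpM2l (sqr_ge0 eps) h3; rewrite /c2.
  move: (newton_dec y) (Lambda / l ^+ 2) (l2norm _) => q Q nv; lra.
- have uE := step_ratioE L gap0 K alpha_gt0 m_gt0 m_M delta_Delta Delta_lt1.
  have h := cubic_remainder_bound l0 Lam_pos q0 nv0 (newton_dir_sqr y) uE.
  rewrite sqr_sqrtr // -/c3 in h; apply: le_trans h.
  apply: ler_wpM2r; first by rewrite mulr_ge0 // exprn_ge0 // (le_trans ler01).
  by apply: ler_wpM2r => //; rewrite lerXn2r ?nnegrE ?le_min ?c30 // ge_min lexx.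
- have h3 := newton_step_cubic y e0; have h2 := newton_step_quad y e0.
  rewrite -/c3 in h3; rewrite -/c2 in h2.
  by rewrite /Num.min; case: ifP => _; move: h2 h3;
    move: (F (y - _)) (F y) (F ystar) (newton_dec y) => a b e q; lra.
Qed.

Variable y : nat -> 'cV[R]_(n * p).
Hypothesis y_step : forall t, y t.+1 = y t - eps *: newton_dir (y t).
Hypothesis gap0E : F (y 0) - F ystar = gap0.

Let zeta_01 := zeta01 gap0 K alpha_gt0 m_gt0 m_M delta_Delta Delta_lt1 L_gt0.

(** The stepsize is tuned to the initial gap, so each use of [newton_gap_step] requires the current
    gap not to exceed it. *)
Lemma gap_decrease t : F (y t) - F ystar <= gap0.
Proof.
elim: t => [|t IH]; first by rewrite gap0E.
have [h _] := newton_gap_step IH; rewrite y_step (le_trans h) //.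
apply: le_trans IH; rewrite ler_piMl ?subr_ge0 //.
have /andP[z0 z1] := zeta_01.
rewrite -[leRHS]sqrtr1 ler_wsqrtr //; lra.
Qed.

Lemma gap_sqrt_rate t :
  F (y t) - F ystar <= Num.sqrt (1 - zeta) ^+ t * gap0.
Proof.
elim: t => [|t IH]; first by rewrite expr0 mul1r gap0E.
have [h _] := newton_gap_step (gap_decrease t); rewrite y_step (le_trans h) //.
by rewrite exprS -mulrA ler_wpM2l // sqrtr_ge0.
Qed.

Lemma gap_rate t : 2 * eps * (Lambda / l ^+ 2 - 1) <= u ->
  F (y t) - F ystar <= (1 - zeta) ^+ t * gap0.
Proof.
move=> hu; elim: t => [|t IH]; first by rewrite expr0 mul1r gap0E.
have [_ /(_ hu) h] := newton_gap_step (gap_decrease t).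
rewrite y_step (le_trans h) // exprS -mulrA ler_wpM2l //.
by have /andP[_ z1] := zeta_01; rewrite subr_ge0.
Qed.

Local Notation s t := (Gamma1_cst alpha m M L delta Delta K gap0 *
  (1 - zeta) `^ ((t%:R - 1) / 4)).

Lemma invsqrt_iterate_change t : (1 - eps) * (1 + s t.+1) < 1 ->
  forall x, l2norm (T (y t.+1) *m x) <= (1 + s t.+1) * l2norm (T (y t) *m x).
Proof.
(* At index t + 1 the exponent is t / 4, matching the gap after t steps; below, r^2 and r^4 are the
   weak and strong rates to the power t. *)
have -> : (t.+1%:R - 1) / 4 = t%:R / 4 :> R by rewrite -natr1 addrK.
move=> eta1 x; apply: le_trans (invsqrt_change (y t) (y t.+1) x) _.
apply: ler_wpM2r; first exact: l2norm_ge0.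
have [e0 e1 _] := stepsize_bounds gap0 K alpha_gt0 m_gt0 m_M delta_Delta
  Delta_lt1 L_gt0.
have /andP[u0 u1] := step_ratio_bounds gap0 K alpha_gt0 m_gt0 m_M delta_Delta
  Delta_lt1 L_gt0.
have /andP[z0 z1] := zeta_01.
have z1' : 0 <= 1 - zeta by rewrite subr_ge0.
set r := (1 - zeta) `^ (t%:R / 4) in eta1 *.
have r0 : 0 <= r by exact: powR_ge0.
have r2 : r ^+ 2 = Num.sqrt (1 - zeta) ^+ t by exact: powR_quarter.
have r4 : r ^+ 4 = (1 - zeta) ^+ t.
  by rewrite (exprM r 2 2) r2 -exprM mulnC exprM sqr_sqrtr.
have r1 : r <= 1.
  rewrite -(@ler_pXn2r _ 4) ?nnegrE // r4 expr1n exprn_ile1 //; lra.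
have Gam0 := Gamma1_ge0 M L delta gap0 K alpha_gt0 m_gt0 Delta_lt1.
set c := alpha * L * _ / d.
have s0 : 0 <= Gamma1_cst alpha m M L delta Delta K gap0 * r.
  by rewrite mulr_ge0.
set w := Num.sqrt (F (y t) - F ystar).
have w2 : w ^+ 2 = F (y t) - F ystar by rewrite sqr_sqrtr // subr_ge0.
have w0 : 0 <= w by exact: sqrtr_ge0.
have b2 : Num.sqrt gap0 ^+ 2 = gap0 by rewrite sqr_sqrtr.
have cle : c <= 2 * (Gamma1_cst alpha m M L delta Delta K gap0 * r) +
    (Gamma1_cst alpha m M L delta Delta K gap0 * r) ^+ 2.
  apply: (@correction_bound _ l Lambda d (Num.sqrt gap0) (alpha * m) eps
    (alpha * L) u r w) => //.
  - exact: mulr_gt0.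
  - exact: mulr_gt0.
  - exact: lambda_am alpha_gt0 m_gt0 m_M delta_Delta Delta_lt1.
  - exact: lambda_d alpha_gt0 m_gt0 m_M delta_Delta Delta_lt1.
  - exact: Lambda_d K alpha_gt0 m_gt0 delta_Delta Delta_lt1.
  - by have := step_ratioE L gap0 K alpha_gt0 m_gt0 m_M delta_Delta Delta_lt1; apply.
  - rewrite -(@ler_pXn2r _ 2) ?nnegrE ?mulr_ge0 ?sqrtr_ge0 // exprMn w2 b2 r2.
    exact: gap_sqrt_rate.
  - move=> hu; rewrite -(@ler_pXn2r _ 2) ?nnegrE ?mulr_ge0 ?sqrtr_ge0 ?sqr_ge0 //.
    by rewrite exprMn w2 b2 -exprM r4 gap_rate.
  - rewrite exprMn (Gamma1_sqr K alpha_gt0 m_gt0 m_M delta_Delta Delta_lt1 L_gt0 gap0_ge0).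
    by rewrite mulrAC.
  rewrite /c; apply: ler_wpM2r; first by rewrite invr_ge0 ltW.
  have -> : alpha * L * eps * Lambda * (Num.sqrt 2 * w / l) =
      alpha * L * (eps * (Lambda * (Num.sqrt 2 * w / l))) by ring.
  apply: ler_wpM2l; first by rewrite mulr_ge0 ?ltW.
  have -> : y t - y t.+1 = eps *: newton_dir (y t) by rewrite y_step opprB addrC subrK.
  rewrite l2normZ (gtr0_norm e0) ler_wpM2l ?(ltW e0) //.
  apply: le_trans (newton_dir_norm (y t)) _.
   apply: ler_wpM2l; first exact: ltW Lam_pos.
  apply: ler_l2norm; first by rewrite divr_ge0 ?sqrtr_ge0 // mulr_ge0 ?sqrtr_ge0.
  have q2 : Num.sqrt (2 : R) ^+ 2 = 2 by rewrite sqr_sqrtr.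
  rewrite expr_div_n exprMn w2 q2 lE invrK mulrAC.
  by have := grad_le_gap W_sym W_ge0 W_stoch f_diff2 alpha_gt0 W_diag hess_bounds
    ystar_argmin (y t) nugt0; apply.
rewrite -[leRHS]gtr0_norm ?ltr_pwDl // -sqrtr_sqr ler_wsqrtr //.
by move: cle; lra.
Qed.

Lemma newton_recursion t : (1 - eps) * (1 + s t.+1) < 1 ->
  l2norm (T (y t.+1) *m g (y t.+2)) <=
    eta_seq alpha m M L delta Delta K gap0 t.+1 * l2norm (T (y t) *m g (y t.+1)) +
    eps ^+ 2 * Gamma2_cst alpha m M L delta Delta K *
      l2norm (T (y t) *m g (y t.+1)) ^+ 2.
Proof.
move=> eta1; have h1 := invsqrt_iterate_change eta1 (g (y t.+1)).
have [e0 e1 _] := stepsize_bounds gap0 K alpha_gt0 m_gt0 m_M delta_Delta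
  Delta_lt1 L_gt0.
rewrite [y t.+2]y_step; apply: le_trans (newton_grad_step (y t.+1) e0 e1) _.
apply: lerD.
  rewrite /eta_seq -mulrA; apply: ler_wpM2l; last exact: h1.
  by rewrite addr_ge0 ?subr_ge0 // mulr_ge0 ?(ltW e0) // exprn_ge0.
rewrite (Gamma2E L K alpha_gt0 m_gt0 m_M delta_Delta Delta_lt1).
(* Passing from |g|^2 to the scaled norm costs the factor nu = 1 / lambda that appears in
   Gamma_2. *)
have h2 := invsqrtmx_lower (Dsym (y t)) dgt0 (Dge (y t)) (Dle (y t)) (g (y t.+1)).
rewrite -(sqr_l2norm (T (y t) *m _)) in h2.
have aL : 0 <= alpha * L / 2 * Lambda ^+ 2 / Num.sqrt d.
  rewrite divr_ge0 ?sqrtr_ge0 // mulr_ge0 ?sqr_ge0 // divr_ge0 // mulr_ge0 ?ltW //.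
apply: le_trans (ler_wpM2l (mulr_ge0 (sqr_ge0 eps) aL) h2) _.
move: (l2norm (T (y t) *m _)) => x; apply: eq_ler; field.
by rewrite gt_eqF // sqrtr_gt0.
Qed.

End Iterates.
End NetworkNewton.

(** * The quadratic phase *)

Theorem theorem2 (R : realType) (n p K : nat)
    (e : rel 'I_n) (W : 'M[R]_n) (f : 'I_n -> 'cV[R]_p -> R)
    (alpha delta Delta m M L : R)
    (ystar : 'cV[R]_(n * p)) (y : nat -> 'cV[R]_(n * p)) (t0 : nat)
    (n_gt0 : (0 < n)%N)
    (network : connected_network e)
    (weights : weight_matrix e W)
    (f_strongly_convex : forall i, strongly_convex (f i))
    (alpha_gt0 : 0 < alpha)
    (delta_ge0 : 0 <= delta) (delta_Delta : delta <= Delta)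
    (Delta_lt1 : Delta < 1)
    (W_diag : forall i, delta <= W i i <= Delta)
    (f_diff2 : forall i, twice_differentiable (f i))
    (m_gt0 : 0 < m) (m_M : m <= M)
    (hess_bounds : forall i x,
      loewner_le m%:M (hessian (f i) x) /\ loewner_le (hessian (f i) x) M%:M)
    (L_gt0 : 0 < L)
    (hess_lipschitz : forall i x x',
      spectral_norm (hessian (f i) x - hessian (f i) x') <= L * l2norm (x - x'))
    (ystar_argmin : forall z, objective alpha W f ystar <= objective alpha W f z) :
  let F := objective alpha W f in
  let gap := F (y 0%N) - F ystar in
  let eps := stepsize alpha m M L delta Delta K gap in
  let Gamma2 := Gamma2_cst alpha m M L delta Delta K in
  let eta := eta_seq alpha m M L delta Delta K gap in
  let g t := grad F (y t) in
  let Dinvsqrt t := invsqrtmx (Dmx alpha W f (y t)) in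
  (forall t, y t.+1 = nn_step alpha W f K eps (y t)) ->
  ((1 <= t0)%N /\ eta t0 < 1 /\ forall s, (1 <= s < t0)%N -> 1 <= eta s) ->
  forall t, (t0 <= t)%N ->
    Num.sqrt (eta t) * (1 - Num.sqrt (eta t)) / (eps ^+ 2 * Gamma2)
      <= l2norm (Dinvsqrt t.-1 *m g t)
      < (1 - Num.sqrt (eta t)) / (eps ^+ 2 * Gamma2) ->
    l2norm (Dinvsqrt t *m g t.+1)
      <= eps ^+ 2 * Gamma2 / (1 - Num.sqrt (eta t))
         * l2norm (Dinvsqrt t.-1 *m g t) ^+ 2.
Proof.
move=> F gap eps Gamma2 eta g Dinvsqrt y_iter [t0_ge1 _] t t0_t /andP[x_lo x_hi].
have [_ W_sym W_ge0 W_stoch _] := weights.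
have gap_ge0 : 0 <= gap by rewrite subr_ge0.
have gE z : grad F z = obj_grad W f alpha z by exact: grad_objective.
have y_step k : y k.+1 = y k - eps *: newton_dir K W f alpha (y k).
  by rewrite y_iter /nn_step gE.
have [e0 e1 _] : [/\ 0 < eps, eps <= 1 & _] :=
  stepsize_bounds gap K alpha_gt0 m_gt0 m_M delta_Delta Delta_lt1 L_gt0.
have Gam2 : 0 < Gamma2 := Gamma2_gt0 K alpha_gt0 m_gt0 m_M delta_Delta Delta_lt1 L_gt0.
have C0 : 0 < eps ^+ 2 * Gamma2 by rewrite mulr_gt0 // exprn_gt0.
case: t t0_t x_lo x_hi => [|t] t0_t x_lo x_hi; first by case: (t0) t0_ge1 t0_t.
move: x_lo x_hi; rewrite /Dinvsqrt /g !gE [t.+1.-1]/=.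
set x := l2norm (invsqrtmx (Dmx alpha W f (y t)) *m obj_grad W f alpha (y t.+1)).
move=> x_lo x_hi.
have x0 : 0 <= x by exact: l2norm_ge0.
set s := Gamma1_cst alpha m M L delta Delta K gap *
  (1 - zeta_cst alpha m M L delta Delta K gap) `^ ((t.+1%:R - 1) / 4).
have s0 : 0 <= s.
  by rewrite mulr_ge0 ?powR_ge0 // (Gamma1_ge0 M L delta gap K alpha_gt0 m_gt0 Delta_lt1).
have rho0 : 0 <= rho_cst alpha m delta.
  by have /andP[] := rho_bounds alpha_gt0 m_gt0 delta_Delta Delta_lt1.
have etaE : eta t.+1 = (1 - eps + eps * rho_cst alpha m delta ^+ K.+1) * (1 + s) by [].
have er0 : 0 <= eps * rho_cst alpha m delta ^+ K.+1.
  by rewrite mulr_ge0 ?exprn_ge0 // ltW.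
have eta_ge : (1 - eps) * (1 + s) <= eta t.+1.
  by rewrite etaE ler_wpM2r ?addr_ge0 // lerDl.
have eta0 : 0 <= eta t.+1.
  by apply: le_trans eta_ge; apply: mulr_ge0; [rewrite subr_ge0|rewrite addr_ge0].
set r := Num.sqrt (eta t.+1) in x_lo x_hi *.
have r0 : 0 <= r by exact: sqrtr_ge0.
have r2 : r ^+ 2 = eta t.+1 by rewrite sqr_sqrtr.
(* A nonnegative norm lies strictly below (1 - r) / (eps^2 Gamma_2), so eta < 1 at this very
   index. *)
have r1 : 0 < 1 - r.
  have := le_lt_trans x0 x_hi.
  by rewrite pmulr_lgt0 ?invr_gt0.
have eta1 : (1 - eps) * (1 + s) < 1.
  by apply: le_lt_trans eta_ge _; rewrite -r2 expr_lt1 // -subr_gt0.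
have := newton_recursion W_sym W_ge0 W_stoch f_diff2 alpha_gt0 m_gt0 m_M delta_Delta
  Delta_lt1 W_diag hess_bounds L_gt0 hess_lipschitz ystar_argmin gap_ge0 y_step
  (erefl gap) eta1.
move=> h; apply: le_trans h _.
change (eta t.+1 * x + eps ^+ 2 * Gamma2 * x ^+ 2 <=
  eps ^+ 2 * Gamma2 / (1 - r) * x ^+ 2).
rewrite -r2.
rewrite ler_pdivrMr // in x_lo.
rewrite [leRHS]mulrAC ler_pdivlMr //.
(* The assumed lower bound times r x gives r^2 x (1 - r) <= r C x^2 with C = eps^2 Gamma_2; adding
   (1 - r) C x^2 leaves C x^2 on the right. *)
have : r * x * (r * (1 - r)) <= r * x * (x * (eps ^+ 2 * Gamma2)).
  by rewrite ler_wpM2l // mulr_ge0.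
lra.
Qed.
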